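(* Let $p$ be a prime and let $G$ be a $2$-generator finite $p$-group of exponent $p^e$. Suppose that $G$ satisfies one of the following conditions: (i) for all $x,y\in G$, we have $x^{p^{e-1}}=y^{p^{e-1}}$ if and only if $(xy^{-1})^{p^{e-1}}=1$; (ii) $G$ is a potent $p$-group. Then $G$ is a Beauville group if and only if $p\ge 5$ and $|G^{p^{e-1}}|\ge p^2$.
   Context: A $2$-generator finite $p$-group is one whose minimal number of generators is $2$, i.e. $|G:\Phi(G)|=p^2$ (so $e\ge 1$). For $i\ge 0$, $G^{p^i}$ denotes the subgroup generated by all $g^{p^i}$, $g\in G$; in particular $G^4$ is the subgroup generated by fourth powers. The terms $\gamma_i(G)$ are those of the lower central series ($\gamma_1(G)=G$, $\gamma_2(G)=G'$). A finite $p$-group $G$ is potent if $\gamma_{p-1}(G)\le G^p$ when $p$ is odd, and if $G'\le G^4$ when $p=2$. For $x,y\in G$ let $\Sigma(x,y)=\bigcup_{g\in G}\big(\langle x\rangle^g\cup\langle y\rangle^g\cup\langle xy\rangle^g\big)$. A Beauville structure for $G$ is a pair of generating sets $\{x_1,y_1\}$, $\{x_2,y_2\}$ of $G$ such that $\Sigma(x_1,y_1)\cap\Sigma(x_2,y_2)=1$. $G$ is a Beauville group if it has a Beauville structure. *)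

(* Defs.v *)
From mathcomp Require Import all_boot all_fingroup all_solvable.

Set Implicit Arguments.
Unset Strict Implicit.
Unset Printing Implicit Defensive.

Local Open Scope group_scope.

(* For a p-group G, 'Mho^i(G) is the subgroup generated by the p^i-th powers of
   its elements (MhoE), so 'Mho^2(G) is the subgroup of fourth powers if p = 2. *)
Definition potent (p : nat) (gT : finGroupType) (G : {group gT}) : bool :=
  p.-group G &&
  (if p == 2 then G^`(1) \subset 'Mho^2(G) else 'L_p.-1(G) \subset 'Mho^1(G)).

Definition Sigma (gT : finGroupType) (G : {group gT}) (x y : gT) : {set gT} :=
  \bigcup_(g in G) (<[x]> :^ g :|: <[y]> :^ g :|: <[x * y]> :^ g).

Definition Beauville_structure (gT : finGroupType) (G : {group gT})
    (x1 y1 x2 y2 : gT) : Prop :=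
  [/\ <<[set x1; y1]>> = G, <<[set x2; y2]>> = G
    & Sigma G x1 y1 :&: Sigma G x2 y2 = 1].

Definition Beauville_group (gT : finGroupType) (G : {group gT}) : Prop :=
  exists x1 y1 x2 y2 : gT, Beauville_structure G x1 y1 x2 y2.

(* Main.v *)
Require Import Defs.
From mathcomp Require Import all_boot all_fingroup all_solvable.

(** Write q = p ^ (e - 1), let W be the subgroup generated by the q-th powers
and R = [W, G]. An element whose q-th power is not 1 has order p ^ e, and the
only subgroup of order p of the cyclic group it generates is generated by its
q-th power. Cyclic subgroups of that kind therefore meet nontrivially exactly
when some nontrivial q-th powers of their elements agree, and the question is
how the q-th power map sees the plane G / Phi(G), a vector space of dimension
2 over the field of p elements, with its p + 1 lines.

The existence half rests on Beauville_of_power_fibres. If elements with equal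
q-th powers are always congruent modulo Phi(G), then cyclic subgroups
generated by elements on different lines, and all their conjugates, intersect
trivially, since conjugation acts trivially on the plane. The triple of a
generating pair x, y occupies three lines; for p >= 5 the pair x y^2, x y^4
has a triple on three other lines.

Under condition (i) the elements with q-th power 1 form a normal subgroup
Omega, and its cosets are the fibres of the q-th power map. An element of
Omega outside Phi(G) belongs to a generating pair, so G / Omega would be
cyclic and W of order at most p; hence Omega is contained in Phi(G) once |W|
>= p^2, and the criterion applies for p >= 5. Conversely, every generating
pair has a member outside Omega. If |W| < p^2, then |W| = p and the q-th power
of such a member generates W, which thus lies in both sets Sigma. If p < 5,
then four lines at most are available, so two triples share a line; G / Omega
has exponent p and two generators, hence class at most 2, and this makes an
element of the second triple congruent modulo Omega to a conjugate of a power
of an element of the first. Their q-th powers agree, and the two sets Sigma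
meet again.

Under condition (ii) with p odd, the input is Hall's formula
(coset_expMg_comm): modulo p-th powers of D and the (p - 2)-fold commutator
[D, G, ..., G], raising to the power p is multiplicative on u and v as soon as
[u, v] lies in D. A normal subgroup N is called potently embedded when [N, G,
..., G], with p - 2 copies of G, is contained in the subgroup generated by the
p-th powers of N; potency of G says that G is potently embedded in itself. The
class is stable under N -> [N, G] and under taking p-th powers, and these two
operations commute. It follows that the q-th power map is multiplicative
modulo R, and that [y^q, x] and [y, x]^q agree modulo the q-th powers of [G',
G]. Suppose now that y^q is in R for some y in a generating pair x, y. Then
[y, x]^q is in [R, G]; since [y, x] generates G' modulo [G', G], all q-th
powers of elements of G' are in [R, G]. They generate R, so R = [R, G] and R =
1 (potent_Mho_central). Consequently either R = 1, the q-th power map is a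
homomorphism and condition (i) holds, or R <> 1 and the fibres of the q-th
power map are as the criterion wants; in the second case |W| >= p^2 since 1 <
R < W, and p <> 3 since for p = 3 potency of W makes [W, G] trivial. For p = 2
the commutator subgroup is contained in the group of fourth powers, and a
similar computation with iterated squares shows that the q-th power map is a
homomorphism, which is condition (i) once more. *)

Set Implicit Arguments.
Unset Strict Implicit.
Unset Printing Implicit Defensive.

Local Open Scope group_scope.

(** * Polynomial sequences in a filtered group *)

Section PolynomialSequences.

Variables (gT : finGroupType) (F : nat -> {group gT}).
Hypothesis F_decr : forall i, F i.+1 \subset F i.
Hypothesis F_comm : forall i j, [~: F i, F j] \subset F (i + j).

Definition diffseq (f : nat -> gT) n := (f n)^-1 * f n.+1.

(** The truncation to the first m differences is what makes the closure
properties provable by induction on m: a difference of a commutator involves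
the commutator itself, of which only the lower differences are then needed. *)
Fixpoint polyseq m d (f : nat -> gT) : Prop :=
  (forall n, f n \in F d) /\ (if m is m'.+1 then polyseq m' d.+1 (diffseq f) else True).

Lemma polyseq_val m d f n : polyseq m d f -> f n \in F d.
Proof. by case: m => [|m] [fF _]. Qed.

Lemma polyseq_eq m d f g : f =1 g -> polyseq m d f -> polyseq m d g.
Proof.
elim: m d f g => [|m IHm] d f g fg [fF Df].
  by split=> // n; rewrite -fg.
split=> [n|]; first by rewrite -fg.
by apply: IHm Df => n; rewrite /diffseq !fg.
Qed.

Lemma polyseq_trunc m d f : polyseq m.+1 d f -> polyseq m d f.
Proof. by elim: m d f => [|m IHm] d f [Ff Df]; split=> //; exact: IHm. Qed.

Lemma polyseq_shift m d f : polyseq m d.+1 f -> polyseq m d f.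
Proof.
elim: m d f => [|m IHm] d f [Ff Df]; split=> //; last exact: IHm Df;
  by move=> n; apply: subsetP (F_decr d) _ (Ff n).
Qed.

Lemma polyseq_leq m d d' f : d <= d' -> polyseq m d' f -> polyseq m d f.
Proof.
elim: d' => [|d' IHd]; first by rewrite leqn0 => /eqP->.
by rewrite leq_eqVlt => /predU1P[-> // | ledd'] /polyseq_shift; apply: IHd.
Qed.

Lemma filt_commg i j x y : x \in F i -> y \in F j -> [~ x, y] \in F (i + j).
Proof. by move=> Fx Fy; apply: subsetP (F_comm i j) _ (mem_commg Fx Fy). Qed.

(** The Lazard-Leibman theorem.  In each of the three cases the difference of
the new sequence is a product of conjugates and commutators of the old
sequences and of their differences, to which the induction hypothesis applies
with one difference less. *)
Lemma polyseq_group m :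
  [/\ forall d f g, polyseq m d f -> polyseq m d g ->
        polyseq m d (fun n => f n * g n),
      forall d f, polyseq m d f -> polyseq m d (fun n => (f n)^-1)
    & forall i j f g, polyseq m i f -> polyseq m j g ->
        polyseq m (i + j) (fun n => [~ f n, g n])].
Proof.
elim: m => [|m [IHM IHV IHR]].
  split=> [d f g [Ff _] [Fg _] | d f [Ff _] | i j f g [Ff _] [Fg _]]; split=> // n.
  - exact: groupM.
  - by rewrite groupV.
  exact: filt_commg.
have IHJ d f g: polyseq m d f -> polyseq m 0 g -> polyseq m d (fun n => f n ^ g n).
  move=> Pf Pg; apply: (@polyseq_eq _ _ (fun n => f n * [~ f n, g n])).
    by move=> n; rewrite conjg_mulR.
  by apply: IHM => //; have:= IHR _ _ _ _ Pf Pg; rewrite addn0.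
split.
- move=> d f g Pf Pg; split=> [n|]; first by rewrite groupM ?(polyseq_val _ Pf) ?(polyseq_val _ Pg).
  apply: (@polyseq_eq _ _ (fun n => diffseq f n ^ g n * diffseq g n)).
    by move=> n; rewrite /diffseq /conjg invMg !mulgA !mulgK.
  apply: IHM (Pg.2); apply: IHJ; first exact: Pf.2.
  exact: polyseq_leq (leq0n d) (polyseq_trunc Pg).
- move=> d f Pf; split=> [n|]; first by rewrite groupV (polyseq_val _ Pf).
  apply: (@polyseq_eq _ _ (fun n => (diffseq f n)^-1 ^ (f n)^-1)).
    by move=> n; rewrite /diffseq /conjg invMg !invgK !mulgA mulgK.
  apply: IHJ; first by apply: IHV; exact: Pf.2.
  exact: polyseq_leq (leq0n d) (IHV _ _ (polyseq_trunc Pf)).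
move=> i j f g Pf Pg; split=> [n|].
  by apply: filt_commg; [apply: polyseq_val Pf | apply: polyseq_val Pg].
(* With f' = f a and g' = g b for the shifted sequences, comparing
   f' g' = g' f' h' with f g = g f h gives h' in terms of h; every factor of
   h^-1 h' below is, up to conjugation, a commutator in which the weights add
   up to more than i + j. *)
pose a := diffseq f; pose b := diffseq g; pose h n := [~ f n, g n].
apply: (@polyseq_eq _ _ (fun n => [~ b n, f n]^-1 ^ (a n * h n) *
  ([~ h n, b n * a n] * [~ a n, b n]) * [~ a n, g n] ^ b n)).
  move=> n; rewrite /a /b /h /diffseq.
  set x := f n; set y := g n; set u := f n.+1; set v := g n.+1.
  by rewrite /commg /conjg !invMg !invgK !mulgA !(mulgKV, mulgK, mulVg, mul1g, mulgV).
have Pf' := polyseq_trunc Pf; have Pg' := polyseq_trunc Pg.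
have Pa : polyseq m i.+1 a := Pf.2; have Pb : polyseq m j.+1 b := Pg.2.
have Ph : polyseq m (i + j) h by apply: IHR.
have Pa0 : polyseq m 1 a by apply: polyseq_leq Pa.
have Pb0 : polyseq m 1 b by apply: polyseq_leq Pb.
apply: (IHM (i + j).+1); first apply: (IHM (i + j).+1).
- apply: IHJ; last exact: IHM (polyseq_leq (leq0n _) Pa) (polyseq_leq (leq0n _) Ph).
  by apply: IHV; rewrite addnC -addSn; apply: IHR.
- apply: (IHM (i + j).+1).
    by rewrite -addn1; apply: IHR => //; apply: IHM.
  by apply: (@polyseq_leq _ _ (i.+1 + j.+1)); [rewrite addSn addnS leqnSn | apply: IHR].
- apply: IHJ; first by rewrite -addSn; apply: IHR.
  exact: polyseq_leq Pb0.
Qed.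

(** The binomial sequences play the role of the monomials: taking the
difference lowers the index i by one and raises the level d by one. *)
Lemma polyseq_binX m d c i : c \in F (d + i) -> polyseq m d (fun n => c ^+ 'C(n, i)).
Proof.
elim: m d i => [|m IHm] d i Fc.
  split=> // n; rewrite groupX //; elim: i Fc => [|i IHi]; rewrite ?addn0 // addnS.
  by move=> Fc; apply: IHi; apply: (subsetP (F_decr _)).
split.
  move=> n; rewrite groupX //; elim: i Fc => [|i IHi]; rewrite ?addn0 // addnS.
  by move=> Fc; apply: IHi; apply: (subsetP (F_decr _)).
case: i Fc => [|i] Fc.
  apply: (@polyseq_eq _ _ (fun=> 1)) => [n|]; first by rewrite /diffseq !bin0 mulVg.
  elim: (m) (d.+1) => [|m' IH] d'; first by split.
  split=> //; by apply: polyseq_eq (IH _) => k; rewrite /diffseq mulVg.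
apply: (@polyseq_eq _ _ (fun n => c ^+ 'C(n, i))) => [n|].
  by rewrite /diffseq binS expgD mulKg.
by apply: IHm; rewrite addSnnS.
Qed.

(** For a sequence vanishing on 0, ..., m - 1 the m-th difference at 0 is just
the value at m. *)
Lemma polyseq_vanish m d f : polyseq m d f -> (forall n, n < m -> f n = 1) -> f m \in F (d + m).
Proof.
elim: m d f => [|m IHm] d f; first by move=> [Ff _] _; rewrite addn0.
case=> _ Df f1; rewrite addnS -addSn.
have:= IHm _ _ Df; rewrite /diffseq f1 // invg1 mul1g; apply=> n ltnm.
by rewrite /diffseq !f1 ?mulVg // ltnS ltnW.
Qed.

(** Taylor expansion: f n is a product of powers c_i ^ C(n, i) with c_i in
F i, and the first two factors disappear because f vanishes at 0 and 1.  The
factors are split off one at a time. *)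
Lemma polyseq_taylor (B : {group gT}) n f :
    polyseq n 0 f -> f 0 = 1 -> f 1%N = 1 -> (1 < n)%N ->
    (forall i c, (1 < i <= n)%N -> c \in F i -> c ^+ 'C(n, i) \in B) ->
  f n \in B.
Proof.
move=> Pf f0 f1 n_gt1 FB.
(* After the first k factors are removed, the remainder g vanishes on
   0, ..., k - 1, and its value at k is the next coefficient. *)
pose Q k := exists2 g, polyseq n 0 g /\ (forall i, i < k -> g i = 1) & f n * (g n)^-1 \in B.
have Qn k : k <= n - 2 -> Q (k + 2).
  elim: k => [_|k IHk ltkn].
    by exists f; rewrite ?mulgV ?group1 //; split=> // [[|[|]]].
  have [|g [Pg g1] fgB] := IHk; first exact: ltnW.
  pose c := g (k + 2).
  have lek2n : k + 2 < n by rewrite addn2; move: ltkn; rewrite ltn_subRL add2n.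
  have Fc : c \in F (k + 2).
    apply: (polyseq_vanish (d := 0)) => //.
    suff trunc j : j <= n -> polyseq j 0 g by apply: trunc; apply: ltnW.
    move: Pg; elim: (n) => [|n' IHn] Pg; first by rewrite leqn0 => /eqP->.
    by rewrite leq_eqVlt => /predU1P[-> // | /IHn]; apply; apply: polyseq_trunc.
  have [PM PV _] := polyseq_group n.
  exists (fun j => (c ^+ 'C(j, k + 2))^-1 * g j).
    split=> [|i]; first by apply: PM => //; apply: PV; apply: polyseq_binX.
    rewrite addSn ltnS leq_eqVlt => /predU1P[-> | ltik].
      by rewrite binn expg1 mulVg.
    by rewrite g1 // bin_small // mulg1 invg1.
  rewrite invMg invgK mulgA groupM // FB // addn2 /=.
  by rewrite -addn2 ltnW.
have [g [Pg g1]] := Qn _ (leqnn (n - 2)).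
rewrite subnK // in g1 *; move=> fB.
have Fg : g n \in F n by apply: (polyseq_vanish (d := 0)).
have:= FB n (g n); rewrite n_gt1 leqnn binn expg1 => /(_ isT Fg) Bg.
by rewrite -(groupMr _ (groupVr Bg)).
Qed.

End PolynomialSequences.

(** * Hall's formula for p-th powers *)

Section HallFormula.

Variable gT : finGroupType.
Implicit Types G H K D N X Y : {group gT}.

Lemma three_subgroup_sub G H K N :
    G \subset 'N(N) -> H \subset 'N(N) -> K \subset 'N(N) ->
    [~: G, H, K] \subset N -> [~: H, K, G] \subset N -> [~: K, G, H] \subset N.
Proof.
move=> nNG nNH nNK sGHK sHKG.
have nR (A B : {set gT}) : A \subset 'N(N) -> B \subset 'N(N) -> [~: A, B] \subset 'N(N).
  exact: comm_subG.
have [nGH nHK nKG] := And3 (nR _ _ nNG nNH) (nR _ _ nNH nNK) (nR _ _ nNK nNG).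
rewrite -(quotient_sub1 (nR _ _ nKG nNH)) !quotientR //.
apply/trivgP; apply: three_subgroup; apply/eqP.
  by rewrite -!quotientR // -subG1 (quotient_sub1 (nR _ _ nGH nNK)).
by rewrite -!quotientR // -subG1 (quotient_sub1 (nR _ _ nHK nNG)).
Qed.

(** This makes the lower central series a filtration in the sense of the
previous part; the induction step is the three subgroup lemma. *)
Lemma lcn_comm G i j : [~: 'L_i(G), 'L_j(G)] \subset 'L_(i + j)(G).
Proof.
elim: j i => [|j IHj] i.
  by rewrite addn0 lcn0 (subset_trans (lcnSnS i G)) // lcn_subS.
case: j IHj => [|j] IHj; first by rewrite addn1 lcn1 lcnSnS.
rewrite lcnSn commGC.
have nL k X : X \subset G -> X \subset 'N('L_k(G)).
  by move=> sXG; apply: subset_trans sXG (lcn_norm _ _).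
apply: three_subgroup_sub; rewrite ?nL ?lcn_sub //.
- rewrite (commGC G); apply: subset_trans (commSg _ (lcnSnS i G)) _.
  by rewrite -addSnnS.
apply: subset_trans (commSg _ (IHj i)) _.
by rewrite [(i + j.+2)%N]addnS lcnSnS.
Qed.

Definition itercomm G N k : {group gT} := iter k (fun X => [~: X, G]%G) N.

Lemma itercommS G N i j : N <| G -> i <= j -> itercomm G N j \subset itercomm G N i.
Proof.
move=> nsNG.
elim: j => [|j IHj]; first by rewrite leqn0 => /eqP->.
rewrite leq_eqVlt => /predU1P[-> // | /IHj]; apply: subset_trans => /=.
rewrite commg_subl; elim: (j) => [|k IHk] /=; first exact: normal_norm.
by rewrite normsR.
Qed.

Lemma lcn_itercomm G D H i :
  H \subset G -> H^`(1) \subset D -> 'L_i.+2(H) \subset itercomm G D i.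
Proof.
move=> sHG sH'D; elim: i => [|i IHi] //=.
by rewrite lcnSn commgSS.
Qed.

Lemma der1_gen2_sub H D u v :
    H :=: <<[set u; v]>> -> H \subset 'N(D) -> [~ u, v] \in D ->
  H^`(1) \subset D.
Proof.
move=> defH nDH Duv; have [Hu Hv]: u \in H /\ v \in H.
  by rewrite defH !mem_gen ?set21 ?set22.
have [nDu nDv]: u \in 'N(D) /\ v \in 'N(D) by rewrite !(subsetP nDH).
apply: der1_min => //; rewrite defH quotient_gen ?subUset ?sub1set ?nDu //.
rewrite abelian_gen /abelian quotientU !quotient_set1 //.
have cuv: commute (coset D u) (coset D v).
  by apply/commgP; rewrite -morphR //= coset_id.
rewrite !subUset !sub1set !centU !inE -!sub1set !cent_set1 !sub1set.
by rewrite !cent1id !andbT /=; apply/andP; split; apply/cent1P.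
Qed.

(** Hall's formula for the prime p. The sequence v^-n u^-n (uv)^n is
polynomial for the lower central series of H = <u, v> and vanishes at 0 and 1,
so its value at p is a product of powers c_i ^ C(p, i) with c_i in 'L_i(H) and
i >= 2. The binomial coefficient is divisible by p for i < p, where c_i lies
in D, and the last factor c_p lies in [D, G, ..., G]. *)
Lemma coset_expMg_comm p G D (B : {group gT}) u v :
    prime p -> p.-group G -> D <| G -> G \subset 'N(B) ->
    u \in G -> v \in G -> [~ u, v] \in D ->
    'Mho^1(D) \subset B -> itercomm G D (p - 2) \subset B ->
  coset B ((u * v) ^+ p) = coset B (u ^+ p) * coset B (v ^+ p).
Proof.
move=> p_pr pG nsDG nBG Gu Gv Duv sMB sCB.
pose H := <<[set u; v]>>%G; pose F i := [group of 'L_i(H)].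
have [Hu Hv]: u \in H /\ v \in H by rewrite !mem_gen ?set21 ?set22.
have sHG: H \subset G by rewrite gen_subG subUset !sub1set Gu.
have sH'D: H^`(1) \subset D.
  by apply: der1_gen2_sub Duv; rewrite // (subset_trans sHG) ?normal_norm.
pose f n := (v ^+ n)^-1 * (u ^+ n)^-1 * (u * v) ^+ n.
have F_decr i : F i.+1 \subset F i by apply: lcn_subS.
have F_comm i j : [~: F i, F j] \subset F (i + j) by apply: lcn_comm.
have Pexp x : x \in H -> polyseq F p 0 (fun n => x ^+ n).
  move=> Hx; apply: (@polyseq_eq _ _ _ _ (fun n => x ^+ 'C(n, 1))) => [n|].
    by rewrite bin1.
  by apply: polyseq_binX => //; rewrite /F /= add0n lcn1.
have [PM PV _] := polyseq_group F_decr F_comm p.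
have Pf : polyseq F p 0 f.
  by apply: (PM); [apply: (PM); apply: (PV); apply: (Pexp) | apply: Pexp; rewrite groupM].
have Bf: f p \in B.
  apply: (@polyseq_taylor _ F F_decr F_comm B p f); rewrite ?prime_gt1 //.
  - by rewrite /f !expg0 invg1 !mulg1.
  - by rewrite /f !expg1 -invMg mulVg.
  case=> [|[|i]] // c /=; rewrite leq_eqVlt => /predU1P[def_p | lti] Fc.
    rewrite def_p binn expg1 (subsetP sCB) // -def_p subn2 /=.
    exact: subsetP (lcn_itercomm i sHG sH'D) _ Fc.
  have Dc: c \in D.
    apply: subsetP (itercommS nsDG (leq0n i)) _ _.
    exact: subsetP (lcn_itercomm i sHG sH'D) _ Fc.
  have/dvdnP[q ->]: p %| 'C(p, i.+2) by apply: prime_dvd_bin.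
  rewrite mulnC expgM groupX // (subsetP sMB) // -{1}[p]expn1 Mho_p_elt //.
  exact: mem_p_elt pG (subsetP (normal_sub nsDG) _ Dc).
have nBX x : x \in G -> x \in 'N(B) by apply: subsetP.
rewrite -morphM ?nBX ?groupX //; apply/rcoset_kercosetP; rewrite ?nBX ?groupM ?groupX ?groupM //.
set w := u ^+ p * v ^+ p; set x := (u * v) ^+ p.
have ->: x \in B :* w = (f p ^ w^-1 \in B).
  by rewrite mem_rcoset conjgE invgK /f -/x -invMg -/w mulgA mulKVg.
by rewrite memJ_norm // groupV nBX ?groupM ?groupX.
Qed.

End HallFormula.

(** * Powers and commutators of potently embedded subgroups *)

(** In a nilpotent group, an inclusion between normal subgroups may be proved
modulo the commutator of the smaller one with G. *)
Lemma nilpotent_sub_commg (gT : finGroupType) (G X Y : {group gT}) :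
    nilpotent G -> X <| G -> Y <| G ->
  X \subset Y <*> [~: X, G] -> X \subset Y.
Proof.
move=> nilG /andP[sXG nXG] /andP[_ nYG] sXYR; have nYX := subset_trans sXG nYG.
have nYR: [~: X, G] \subset 'N(Y) by rewrite comm_subG.
have sXY: X / Y \subset G / Y :&: [~: X / Y, G / Y].
  by rewrite subsetI quotientS // -quotientR //= -(quotientYidl nYR) quotientS.
have/forall_inP/(_ (X / Y)%G sXY)/eqP X1 := quotient_nil Y nilG.
by rewrite -quotient_sub1 // X1.
Qed.

Lemma nil_comm_proper (gT : finGroupType) (G N : {group gT}) :
  nilpotent G -> N <| G -> N :!=: 1 -> [~: N, G] \proper N.
Proof.
move=> nilG /andP[sNG nNG] ntN.
by apply: (nil_comm_properl nilG) => //; rewrite subsetI subxx.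
Qed.

Section PowerKernel.

Variables (gT : finGroupType) (M B : {group gT}) (n : nat).
Hypothesis nBM : M \subset 'N(B).
Hypothesis expM : {in M &, forall x y,
  coset B ((x * y) ^+ n) = coset B (x ^+ n) * coset B (y ^+ n)}.

(** Being a group, it contains M as soon as it contains generators of M; this is
how statements about the n-th powers of all elements of M are proved. *)
Definition powker := [set x in M | x ^+ n \in B].

Lemma powker_group_set : group_set powker.
Proof.
apply/group_setP; split=> [|x y]; first by rewrite inE group1 expg1n group1.
rewrite !inE => /andP[Mx Bx] /andP[My By]; rewrite groupM //=.
apply: coset_idr; first by rewrite (subsetP nBM) ?groupX ?groupM.
by rewrite expM // !coset_id // mulg1.
Qed.

End PowerKernel.

Section PotentlyEmbedded.

Variables (gT : finGroupType) (p : nat) (G : {group gT}).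
Hypotheses (p_pr : prime p) (pG : p.-group G).
Implicit Types B D M N X : {group gT}.

Let nilG : nilpotent G := pgroup_nil pG.

Lemma Mho_expg N k x : N \subset G -> x \in N -> x ^+ (p ^ k) \in 'Mho^k(N).
Proof. by move=> sNG Nx; rewrite Mho_p_elt // (mem_p_elt (pgroupS sNG pG) Nx). Qed.

Lemma Mho1_expg N x : N \subset G -> x \in N -> x ^+ p \in 'Mho^1(N).
Proof. by move=> sNG /(Mho_expg 1 sNG); rewrite expn1. Qed.

Lemma Mho_subP N B k :
    N \subset G -> (forall x, x \in N -> x ^+ (p ^ k) \in B) ->
  'Mho^k(N) \subset B.
Proof.
move=> sNG NB; rewrite (MhoE _ (pgroupS sNG pG)) gen_subG.
by apply/subsetP=> _ /imsetP[x Nx ->]; apply: NB.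
Qed.

Lemma Mho_normal_trans N k : N <| G -> 'Mho^k(N) <| G.
Proof. exact: char_normal_trans (Mho_char k N). Qed.

Lemma commg_normal_trans N : N <| G -> [~: N, G] <| G.
Proof.
case/andP=> sNG nNG; rewrite /normal comm_subG //=.
by rewrite normsR // normG.
Qed.

Lemma itercommSr N k : itercomm G N k.+1 = itercomm G [~: N, G]%G k.
Proof. by rewrite /itercomm iterSr. Qed.

Lemma comm_Mho_subP N B k :
    N <| G -> G \subset 'N(B) ->
    {in N & G, forall x g, [~ x ^+ (p ^ k), g] \in B} ->
  [~: 'Mho^k(N), G] \subset B.
Proof.
move=> nsNG nBG NB; have sNG := normal_sub nsNG.
have nBM: 'Mho^k(N) \subset 'N(B).
  by rewrite (subset_trans (Mho_sub k N)) ?(subset_trans sNG).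
rewrite -quotient_cents2 // (MhoE _ (pgroupS sNG pG)) quotient_gen; last first.
  by apply/subsetP=> _ /imsetP[x Nx ->]; rewrite (subsetP nBG) ?groupX ?(subsetP sNG).
rewrite gen_subG quotientE; apply/subsetP=> _ /morphimP[_ _ /imsetP[x Nx ->] ->].
apply/centP=> _ /morphimP[g nBg Gg ->]; apply/commgP.
have nBx: x ^+ (p ^ k) \in 'N(B) by rewrite (subsetP nBG) ?groupX ?(subsetP sNG).
by rewrite -morphR //= coset_id // NB.
Qed.

Lemma coset_commXg B x g n :
    G \subset 'N(B) -> x \in G -> g \in G ->
  coset B [~ x ^+ n, g] =
    (coset B (x ^+ n))^-1 * coset B ((x * [~ x, g]) ^+ n).
Proof.
move=> nBG Gx Gg; have nB y : y \in G -> y \in 'N(B) by apply: (subsetP nBG).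
have nBx: x ^+ n \in 'N(B) by rewrite nB ?groupX.
have nBxg: (x * [~ x, g]) ^+ n \in 'N(B) by exact: nB _ (groupX n (groupM Gx (groupR Gx Gg))).
by rewrite commgEl conjXg conjg_mulR morphM ?groupV // morphV.
Qed.

(** For N = G and p odd this is the condition that G is potent. *)
Definition potemb N := N <| G /\ itercomm G N (p - 2) \subset 'Mho^1(N).

Lemma potemb_normal N : potemb N -> N <| G. Proof. by case. Qed.

(** Hall's formula for (x [x, g])^p = (x^p)^g expresses [x^p, g] as
[x, g]^p up to p-th powers of [N, G, G] and up to the p-fold commutator of N,
which potency turns into [N^p, G, G].  The latter is absorbed by
nilpotency. *)
Lemma Mho1_comm_sub N : potemb N -> [~: 'Mho^1(N), G] \subset 'Mho^1([~: N, G]).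
Proof.
case=> nsNG sCN; pose M := [~: N, G]%G; pose X := [~: 'Mho^1(N), G]%G.
have sNG := normal_sub nsNG; have nsMG: M <| G := commg_normal_trans nsNG.
have sMG := normal_sub nsMG.
have nsXG: X <| G by apply/commg_normal_trans/Mho_normal_trans.
have nsYG: 'Mho^1(M) <| G by apply: Mho_normal_trans.
apply: (@nilpotent_sub_commg _ G X) => //.
pose B := ('Mho^1(M) <*> [~: X, G])%G.
have sMB: 'Mho^1(M) \subset B by apply: joing_subl.
have nBG: G \subset 'N(B).
  by rewrite normsY ?normal_norm ?commg_normal_trans ?Mho_normal_trans.
apply: comm_Mho_subP => // x g Nx Gg; rewrite expn1.
have Gx := subsetP sNG x Nx.
have Mxg: [~ x, g] \in M by apply: mem_commg.
have Gxg := subsetP sMG _ Mxg.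
have nBx: x ^+ p \in 'N(B) by rewrite (subsetP nBG) ?groupX.
have eqxg: coset B ((x * [~ x, g]) ^+ p) = coset B (x ^+ p).
  rewrite (@coset_expMg_comm _ p G [~: M, G]%G) ?commg_normal_trans //.
  - by rewrite (coset_id (x := [~ x, g] ^+ p)) ?mulg1 // (subsetP sMB) ?Mho1_expg.
  - by rewrite -invg_comm groupV mem_commg.
  - by apply: subset_trans (MhoS _ _) sMB; rewrite commg_subl normal_norm.
  rewrite -!itercommSr /= (subset_trans _ (joing_subr _ _)) // commSg //.
  exact: commSg.
apply: coset_idr; first by rewrite (subsetP nBG) ?groupR ?groupX.
by rewrite coset_commXg // eqxg mulVg.
Qed.

Lemma potemb_commg N : potemb N -> potemb [~: N, G]%G.
Proof.
move=> peN; have [nsNG sCN] := peN; split; first exact: commg_normal_trans.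
rewrite -itercommSr /=; apply: subset_trans (Mho1_comm_sub peN).
exact: commSg.
Qed.

Lemma potemb_itercomm N k : potemb N -> potemb (itercomm G N k).
Proof. by move=> peN; elim: k => // k; apply: potemb_commg. Qed.

Lemma itercomm_Mho1 N k :
  potemb N -> itercomm G 'Mho^1(N)%G k \subset 'Mho^1(itercomm G N k).
Proof.
move=> peN; elim: k => // k IHk /=.
exact: subset_trans (commSg _ IHk) (Mho1_comm_sub (potemb_itercomm k peN)).
Qed.

Lemma potemb_Mho1 N : potemb N -> potemb 'Mho^1(N)%G.
Proof.
move=> peN; have [nsNG sCN] := peN; split; first exact: Mho_normal_trans.
exact: subset_trans (itercomm_Mho1 _ peN) (MhoS _ sCN).
Qed.

(** For a potently embedded D the commutator term of Hall's formula is already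
among the p-th powers. *)
Lemma coset_expMg D B u v :
    potemb D -> G \subset 'N(B) -> 'Mho^1(D) \subset B ->
    u \in G -> v \in G -> [~ u, v] \in D ->
  coset B ((u * v) ^+ p) = coset B (u ^+ p) * coset B (v ^+ p).
Proof.
case=> nsDG sCD nBG sMB Gu Gv Duv.
by apply: (coset_expMg_comm p_pr pG nsDG) => //; apply: subset_trans sMB.
Qed.

Lemma potemb_powker_group_set M B :
    M <| G -> G \subset 'N(B) -> 'Mho^1([~: M, G]) \subset B -> potemb M ->
  group_set (powker M B p).
Proof.
move=> nsMG nBG sB peM; have sMG := normal_sub nsMG.
apply: powker_group_set; first exact: subset_trans nBG.
move=> x y Mx My; apply: (coset_expMg (potemb_commg peM)) => //.
- exact: (subsetP sMG).
- exact: (subsetP sMG).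
by rewrite mem_commg // (subsetP sMG).
Qed.

(** For the inclusion from left to right, by induction on N, p-th powers are
multiplicative on M = [N, G] modulo p-th powers of [M, G], which the statement
for the smaller group M places in [M^p, G]. So it is enough to look at the
generators [x, g] of M, and [x, g]^p is [x^p, g] up to the same error. *)
Lemma Mho1_commE N : potemb N -> 'Mho^1([~: N, G]) = [~: 'Mho^1(N), G].
Proof.
move=> peN; apply/eqP; rewrite eqEsubset Mho1_comm_sub // andbT.
have [n] := ubnP #|N|; elim: n N peN => // n IHn N peN /ltnSE-leNn.
have [N1 | ntN] := eqVneq (N : {set gT}) 1.
  by rewrite N1 comm1G (subset_trans (Mho_sub _ [1 gT]%G)) ?sub1G.
pose M := [~: N, G]%G; have peM: potemb M := potemb_commg peN.
have [nsNG nsMG] := (potemb_normal peN, potemb_normal peM).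
have [sNG sMG] := (normal_sub nsNG, normal_sub nsMG).
have{IHn} sRM: 'Mho^1([~: M, G]) \subset [~: 'Mho^1(M), G].
  apply: IHn => //; apply: leq_trans leNn; apply: proper_card.
  exact: nil_comm_proper.
apply: (@nilpotent_sub_commg _ G) => //=; rewrite ?commg_normal_trans ?Mho_normal_trans //.
pose B := ([~: 'Mho^1(N), G] <*> [~: 'Mho^1(M), G])%G.
have nBG: G \subset 'N(B).
  by rewrite normsY ?normal_norm ?commg_normal_trans ?Mho_normal_trans.
have sRB := subset_trans sRM (joing_subr [~: 'Mho^1(N), G] _).
have gK := potemb_powker_group_set nsMG nBG sRB peM.
suffices /subsetP sMK: M \subset Group gK.
  by apply: (@Mho_subP M B) => // x /sMK /setIdP[_]; rewrite expn1.
rewrite gen_subG; apply/subsetP=> _ /imset2P[x g Nx Gg ->].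
have Gx := subsetP sNG x Nx.
have Mxg: [~ x, g] \in M by apply: mem_commg.
have Gxg := subsetP sMG _ Mxg.
rewrite inE Mxg /=.
have: coset B ((x * [~ x, g]) ^+ p) = coset B (x ^+ p) * coset B ([~ x, g] ^+ p).
  apply: (coset_expMg (potemb_commg peM)) => //.
  by rewrite -invg_comm groupV mem_commg.
have nBx: x ^+ p \in 'N(B) by rewrite (subsetP nBG) ?groupX.
rewrite -conjg_mulR -conjXg [_ ^ g]conjg_mulR morphM //; last first.
  by rewrite (subsetP nBG) ?groupR ?groupX.
rewrite /= (coset_id (x := [~ x ^+ p, g])); last first.
  by rewrite (subsetP (joing_subl _ _)) ?mem_commg ?Mho1_expg.
by move/mulgI/esym/coset_idr; apply; rewrite (subsetP nBG) ?groupX.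
Qed.

(** Iterating p-th powers k times gives nothing more than the group generated by
the p^k-th powers, although an element of 'Mho^k(N) is only a product of such
powers: p-th powers are multiplicative on A = 'Mho^k(N) modulo [A^p, G], and
nilpotency removes this error. *)
Lemma potemb_Mho_Mho1 N k :
  potemb N -> potemb 'Mho^k(N)%G /\ 'Mho^1('Mho^k(N)) = 'Mho^k.+1(N).
Proof.
move=> peN; have sNG := normal_sub (potemb_normal peN).
have Mho1Mho j : potemb 'Mho^j(N)%G -> 'Mho^1('Mho^j(N)) = 'Mho^j.+1(N).
  set A := ('Mho^j(N))%G => peA.
  have nsAG := potemb_normal peA; have sAG := normal_sub nsAG.
  apply/eqP; rewrite eqEsubset; apply/andP; split; last first.
    apply: (@Mho_subP N 'Mho^1(A)%G) => // x Nx.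
    by rewrite expnSr expgM Mho1_expg // Mho_expg.
  have nsMA: 'Mho^1(A) <| G by apply: Mho_normal_trans.
  have nsMN: 'Mho^j.+1(N) <| G by apply/Mho_normal_trans/potemb_normal.
  apply: (@nilpotent_sub_commg _ G) => //=.
  pose B := ('Mho^j.+1(N) <*> [~: 'Mho^1(A), G])%G.
  have nBG: G \subset 'N(B) by rewrite normsY ?normal_norm ?commg_normal_trans.
  have sRB: 'Mho^1([~: A, G]) \subset B by rewrite Mho1_commE ?joing_subr.
  have gK := potemb_powker_group_set nsAG nBG sRB peA.
  suffices /subsetP sAK: A \subset Group gK.
    by apply: (@Mho_subP A B) => // x /sAK /setIdP[_]; rewrite expn1.
  apply: Mho_subP => // x Nx; rewrite inE Mho_expg //= -expgM -expnSr.
  by rewrite (subsetP (joing_subl _ _)) ?Mho_expg.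
suffices peNk: potemb 'Mho^k(N)%G by split=> //; apply: Mho1Mho.
elim: k => [|k IHk]; first by rewrite (_ : 'Mho^0(N)%G = N) //; apply/val_inj/Mho0.
rewrite (_ : 'Mho^k.+1(N)%G = 'Mho^1('Mho^k(N))%G); first exact: potemb_Mho1.
by apply/val_inj; rewrite /= Mho1Mho.
Qed.

Lemma potemb_Mho N k : potemb N -> potemb 'Mho^k(N)%G.
Proof. by case/(potemb_Mho_Mho1 k). Qed.

Lemma Mho1_Mho N k : potemb N -> 'Mho^1('Mho^k(N)) = 'Mho^k.+1(N).
Proof. by case/(potemb_Mho_Mho1 k). Qed.

Lemma Mho_commE N k : potemb N -> 'Mho^k([~: N, G]) = [~: 'Mho^k(N), G].
Proof.
move=> peN; elim: k => [|k IHk]; first by rewrite !Mho0.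
rewrite -(Mho1_Mho _ peN) -Mho1_commE /=; last exact: potemb_Mho.
by rewrite -IHk Mho1_Mho //; apply: potemb_commg.
Qed.

(** This keeps the hypothesis of coset_expMg alive when u and v are replaced by
their powers. *)
Lemma commg_expg_Mho D u v k :
    potemb D -> u \in G -> v \in G -> [~ u, v] \in D ->
  [~ u ^+ (p ^ k), v] \in 'Mho^k(D).
Proof.
move=> peD Gu Gv Duv.
have step E x : potemb E -> x \in G -> [~ x, v] \in E -> [~ x ^+ p, v] \in 'Mho^1(E).
  move=> peE Gx Exv; have nsEG := potemb_normal peE; have sEG := normal_sub nsEG.
  have nsMG: 'Mho^1(E) <| G by apply: Mho_normal_trans.
  have nMG := subsetP (normal_norm nsMG).
  have Gxv := groupR Gx Gv.
  apply: coset_idr; first by rewrite nMG ?groupR ?groupX.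
  rewrite coset_commXg ?normal_norm // (coset_expMg (potemb_commg peE)) ?normal_norm //.
  - by rewrite mulKg coset_id // Mho1_expg.
  - by rewrite MhoS // commg_subl normal_norm.
  by rewrite -invg_comm groupV mem_commg.
elim: k => [|k IHk]; first by rewrite Mho0.
rewrite expnSr expgM -(Mho1_Mho _ peD); apply: step; rewrite ?groupX //.
exact: potemb_Mho.
Qed.

(** The formula for exponent p^k follows by raising the one for the previous
exponent to the power p; the error factor d in 'Mho^k(D) contributes d^p only,
as its commutators with everything are in 'Mho^k(D) as well. *)
Lemma coset_expMgX D B u v k :
    potemb D -> G \subset 'N(B) -> 'Mho^k(D) \subset B ->
    u \in G -> v \in G -> [~ u, v] \in D ->
  coset B ((u * v) ^+ (p ^ k)) = coset B (u ^+ (p ^ k)) * coset B (v ^+ (p ^ k)).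
Proof.
move=> peD nBG sMB Gu Gv Duv.
suffices: (u * v) ^+ (p ^ k) \in 'Mho^k(D) :* (u ^+ (p ^ k) * v ^+ (p ^ k)).
  move/(subsetP (mulSg _ sMB))/rcoset_kercosetP=> ->; rewrite ?morphM //;
  by rewrite (subsetP nBG) ?groupM ?groupX ?groupM.
elim: k {B nBG sMB} => [|k IHk]; first by rewrite Mho0 rcoset_refl.
pose E := 'Mho^k(D)%G; have peE: potemb E := potemb_Mho k peD.
have nsEG := potemb_normal peE; have sEG := normal_sub nsEG.
have nEG := subsetP (normal_norm nsEG).
set u' := u ^+ (p ^ k); set v' := v ^+ (p ^ k).
have [Gu' Gv'] : u' \in G /\ v' \in G by rewrite !groupX.
have nsMG: 'Mho^1(E) <| G by apply: Mho_normal_trans.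
have nMG := subsetP (normal_norm nsMG).
rewrite -Mho1_Mho //; apply/rcoset_kercosetP; rewrite ?nMG ?groupM ?groupX ?groupM //.
have Euv: [~ u', v'] \in E.
  apply: coset_idr; first by rewrite nEG ?groupR.
  rewrite morphR ?nEG //=.
  have cuv: commute (coset E u') (coset E v).
    by apply/commgP; rewrite -morphR ?nEG //= coset_id // commg_expg_Mho.
  have ->: coset E v' = coset E v ^+ (p ^ k) by rewrite morphX ?nEG.
  by apply/eqP/commgP/commuteX.
move: IHk; rewrite norm_rlcoset ?nEG ?groupM // => /lcosetP[d Ed].
rewrite !expnSr !expgM -/u' -/v' => ->; rewrite -mulgA.
have Gd := subsetP sEG d Ed; have nMEG := normal_norm nsMG.
have Gvd: v' * d \in G by apply: groupM.
have Edx x : x \in G -> [~ x, d] \in E.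
  move=> Gx; rewrite -invg_comm groupV.
  by apply: subsetP (mem_commg Ed Gx); rewrite commg_subl normal_norm.
have Euvd: [~ u', v' * d] \in E.
  by rewrite commgMJ; apply: groupM (Edx _ Gu') _; rewrite memJ_norm // nEG.
rewrite (coset_expMg peE nMEG (subxx _) Gu' Gvd Euvd).
rewrite (coset_expMg peE nMEG (subxx _) Gv' Gd (Edx _ Gv')).
rewrite (coset_id (x := d ^+ p)) ?Mho1_expg // mulg1.
by rewrite morphM ?nMG ?groupX.
Qed.

End PotentlyEmbedded.

(** * Potent p-groups *)

Section PotentGroups.

Variables (gT : finGroupType) (p : nat) (G : {group gT}).
Hypotheses (p_pr : prime p) (pG : p.-group G) (peG : potemb p G G).

Let nilG : nilpotent G := pgroup_nil pG.

Lemma potent_expMg k x y :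
    x \in G -> y \in G ->
  coset [~: 'Mho^k(G), G] ((x * y) ^+ (p ^ k)) =
    coset [~: 'Mho^k(G), G] (x ^+ (p ^ k)) * coset [~: 'Mho^k(G), G] (y ^+ (p ^ k)).
Proof.
move=> Gx Gy; have peG' := potemb_commg p_pr pG peG.
apply: (coset_expMgX p_pr pG (B := [~: 'Mho^k(G), G]%G) peG') => //.
- exact: commg_normr.
- by rewrite (Mho_commE p_pr pG k peG).
exact: mem_commg.
Qed.

(** With W = 'Mho^k(G), the group R = [W, G] is generated by the p^k-th powers
of G', and T = [R, G] by those of [G', G]. The commutator [y^(p^k), x] is in T
and agrees with [y, x]^(p^k) modulo T. Since [y, x] generates G' modulo [G',
G], all p^k-th powers of G' are in T, so R = [R, G]. *)
Lemma potent_Mho_central k x y :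
    G :=: <<[set x; y]>> -> y ^+ (p ^ k) \in [~: 'Mho^k(G), G] ->
  [~: 'Mho^k(G), G] = 1.
Proof.
move=> defG Ry; pose R := [~: 'Mho^k(G), G]%G.
have [Gx Gy]: x \in G /\ y \in G by rewrite defG !mem_gen ?set21 ?set22.
pose M := [~: G, G]%G; pose L := [~: M, G]%G; pose T := [~: R, G]%G.
have peM : potemb p G M := potemb_commg p_pr pG peG.
have peL : potemb p G L := potemb_commg p_pr pG peM.
have defR : 'Mho^k(M) = R := Mho_commE p_pr pG k peG.
have defT : 'Mho^k(L) = T by rewrite (Mho_commE p_pr pG k peM) defR.
have nsRG : R <| G by apply/commg_normal_trans/gFnormal.
have nsTG : T <| G by apply/commg_normal_trans.
have [nTG sTG] := (normal_norm nsTG, normal_sub nsTG).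
have sMG : M \subset G by apply: der1_subG.
have Myx : [~ y, x] \in M by apply: mem_commg.
have Tyx : [~ y, x] ^+ (p ^ k) \in T.
  apply: coset_idr; first by rewrite (subsetP nTG) // groupX // (subsetP sMG).
  have Tyqx : [~ y ^+ (p ^ k), x] \in T by apply: mem_commg.
  have:= coset_commXg (p ^ k) nTG Gy Gx; rewrite coset_id //.
  have Gyx := subsetP sMG _ Myx.
  rewrite (coset_expMgX p_pr pG peL) ?defT //; first by rewrite mulKg.
  by rewrite -invg_comm groupV mem_commg.
have gK : group_set (powker M T (p ^ k)).
  apply: powker_group_set => [|a b Ma Mb]; first exact: subset_trans nTG.
  have [Ga Gb] := (subsetP sMG a Ma, subsetP sMG b Mb).
  by rewrite (coset_expMgX p_pr pG peL) ?defT // mem_commg.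
have sLK : L \subset Group gK.
  apply/subsetP=> z Lz; have sLM : L \subset M by rewrite commg_subl normsR.
  rewrite inE (subsetP sLM) // -defT (Mho_expg pG) //.
  exact: subset_trans sLM sMG.
have sKM : Group gK \subset M by apply/subsetP=> z /setIdP[].
have nKG : G \subset 'N(Group gK).
  by rewrite -commg_subl (subset_trans _ sLK) // commSg.
have sMK : M \subset Group gK.
  apply: (der1_gen2_sub (u := y) (v := x)) => //; first by rewrite setUC.
  by rewrite inE Myx.
have sRT : R \subset T.
  rewrite -defR; apply: (Mho_subP pG) => // z Mz.
  by have:= subsetP sMK z Mz; rewrite inE => /andP[].
apply/eqP; apply: contraLR sRT => ntR.
by have /properP[_ [z Rz Tz]] := nil_comm_proper nilG nsRG ntR; apply/subsetPn; exists z.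
Qed.

(** For p = 3 being potently embedded reads [W, G] <= W^3, and here the
right-hand side is generated by elements z^(p^(k+1)) = 1. *)
Lemma potent3_Mho_central k :
  p = 3 -> exponent G %| p ^ k.+1 -> [~: 'Mho^k(G), G] = 1.
Proof.
move=> p3 expG; have peW := potemb_Mho p_pr pG k peG.
have sWG : 'Mho^k(G) \subset G by apply: Mho_sub.
apply/trivgP; have [_] := peW; rewrite p3 /= => /subset_trans-> //.
rewrite (Mho1_Mho p_pr pG k peG); apply: (Mho_subP pG (B := 1%G)) => // x Gx.
by rewrite inE (exponentP expG).
Qed.

End PotentGroups.

(** * Powerful 2-groups *)

Section Powerful2Groups.

Variables (gT : finGroupType) (G : {group gT}).
Hypothesis pG : 2.-group G.
Implicit Types N X Y : {group gT}.

Let nilG : nilpotent G := pgroup_nil pG.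

(** The squares of X lie in its Frattini subgroup, so they may be neglected
along with the error [X, G]. *)
Lemma sub_Mho1_commg X Y :
    X <| G -> Y <| G -> X \subset Y <*> ('Mho^1(X) <*> [~: X, G]) ->
  X \subset Y.
Proof.
move=> nsXG nsYG sXY.
have nsRG : [~: X, G] <| G by apply: commg_normal_trans.
apply: (nilpotent_sub_commg nilG) => //.
pose Z := (Y <*> [~: X, G])%G; have sXG := normal_sub nsXG.
have nZX : X \subset 'N(Z) by rewrite (subset_trans sXG) // normsY ?normal_norm.
have nZM : 'Mho^1(X) \subset 'N(Z) by apply: subset_trans (Mho_sub _ _) nZX.
rewrite -(quotient_sub1 nZX); apply/contraT => ntXZ.
have pXZ : 2.-group (X / Z) by rewrite quotient_pgroup ?(pgroupS sXG).
have /properP[_ [z Xz /negP[]]] : 'Phi(X / Z) \proper X / Z.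
  by apply: Phi_proper; rewrite -subG1.
apply: subsetP z Xz; rewrite (Phi_joing pXZ).
apply: subset_trans (joing_subr _ _); rewrite -(morphim_Mho _ _ nZX) -quotientE.
rewrite -(quotientYidr nZM) quotientS //=.
by apply: subset_trans sXY _; rewrite joingA (joingC Y) -joingA.
Qed.

(** For p = 2 Hall's formula has the single error term c_2, a commutator in
[N, G, G]. *)
Lemma Mho1_comm_sub2 N :
  N <| G -> [~: 'Mho^1(N), G] \subset 'Mho^1([~: N, G]) <*> [~: N, G, G].
Proof.
move=> nsNG; pose M := [~: N, G]%G; pose D := [~: M, G]%G.
have sNG := normal_sub nsNG; have nsMG : M <| G := commg_normal_trans nsNG.
have sMG := normal_sub nsMG; have nsDG : D <| G := commg_normal_trans nsMG.
pose B := ('Mho^1(M) <*> D)%G.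
have [sMB sDB]: 'Mho^1(M) \subset B /\ D \subset B by rewrite joing_subl joing_subr.
have nBG: G \subset 'N(B) by rewrite normsY ?normal_norm ?Mho_normal_trans.
apply: (comm_Mho_subP pG (B := B)) => // x g Nx Gg; rewrite expn1.
have Gx := subsetP sNG x Nx.
have Mxg: [~ x, g] \in M by apply: mem_commg.
have Gxg := subsetP sMG _ Mxg.
apply: coset_idr; first by rewrite (subsetP nBG) ?groupR ?groupX.
rewrite (coset_commXg 2 nBG) // (@coset_expMg_comm _ 2 G D) //.
- by rewrite mulKg coset_id // (subsetP sMB) // (Mho1_expg pG).
- by rewrite -invg_comm groupV mem_commg.
by rewrite (subset_trans _ sDB) // Mho_sub.
Qed.

(** Asking for two successive squarings, and not for fourth powers, makes the
condition visibly stable under squaring; both versions agree by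
powemb2_Mho_Mho1. *)
Definition powemb2 N := N <| G /\ [~: N, G] \subset 'Mho^1('Mho^1(N)).

(** With N1, N2, N3 the iterated squares of N and X = [N1, G], the previous
lemma bounds X by N3 and [N2, G], and, applied to N1, it bounds [N2, G] by the
squares of X and [X, G], both negligible for an upper bound on X. *)
Lemma powemb2_Mho1 N : powemb2 N -> powemb2 'Mho^1(N)%G.
Proof.
case=> nsNG sRN; pose N1 := 'Mho^1(N)%G; pose N2 := 'Mho^1(N1)%G; pose N3 := 'Mho^1(N2)%G.
have nsN1 : N1 <| G by apply: Mho_normal_trans.
have nsN2 : N2 <| G by apply: Mho_normal_trans.
have nsN3 : N3 <| G by apply: Mho_normal_trans.
split=> //; pose X := [~: N1, G]%G.
apply: (@sub_Mho1_commg X N3) => //; first exact: commg_normal_trans.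
apply: subset_trans (Mho1_comm_sub2 nsNG) _; rewrite join_subG; apply/andP; split.
  by apply: subset_trans (joing_subl _ _); apply: MhoS.
apply: subset_trans (joing_subr _ _).
apply: subset_trans (Mho1_comm_sub2 nsN1).
exact: commSg.
Qed.

(** On A = 'Mho^k(N) squaring is multiplicative modulo [A, G], which lies in
the subgroup generated by the squares of X = 'Mho^1(A) and is therefore
negligible when bounding X. *)
Lemma powemb2_Mho_Mho1 N k :
  powemb2 N -> powemb2 'Mho^k(N)%G /\ 'Mho^1('Mho^k(N)) = 'Mho^k.+1(N).
Proof.
move=> peN; have nsNG := peN.1; have sNG := normal_sub nsNG.
have Mho1Mho j : powemb2 'Mho^j(N)%G -> 'Mho^1('Mho^j(N)) = 'Mho^j.+1(N).
  set A := ('Mho^j(N))%G => -[nsAG sRA]; have sAG := normal_sub nsAG.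
  apply/eqP; rewrite eqEsubset; apply/andP; split; last first.
    apply: (Mho_subP pG (B := 'Mho^1(A)%G)) => // x Nx.
    by rewrite expnSr expgM (Mho1_expg pG) // (Mho_expg pG).
  pose X := 'Mho^1(A)%G; have nsX : X <| G by apply: Mho_normal_trans.
  have nsY: 'Mho^j.+1(N) <| G by apply/Mho_normal_trans.
  apply: (@sub_Mho1_commg X 'Mho^j.+1(N)%G) => //.
  pose B := ('Mho^j.+1(N) <*> ('Mho^1(X) <*> [~: X, G]))%G.
  have nBG: G \subset 'N(B).
    by rewrite !normsY ?normal_norm ?commg_normal_trans ?Mho_normal_trans.
  have sRB : 'Mho^1(X) \subset B.
    by apply: subset_trans (joing_subr _ _); apply: joing_subl.
  have gK : group_set (powker A B 2).
    apply: powker_group_set => [|a b Aa Ab]; first exact: subset_trans nBG.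
    have [Ga Gb] := (subsetP sAG a Aa, subsetP sAG b Ab).
    apply: (@coset_expMg_comm _ 2 G 'Mho^1(X)%G) => //.
    - exact: Mho_normal_trans.
    - by apply: (subsetP sRA); apply: mem_commg.
    by apply: subset_trans (Mho_sub _ _) sRB.
  suffices /subsetP sAK: A \subset Group gK.
    by apply: (Mho_subP pG (B := B)) => // x /sAK /setIdP[_]; rewrite expn1.
  apply: (Mho_subP pG) => // x Nx; rewrite inE (Mho_expg pG) //= -expgM -expnSr.
  by rewrite (subsetP (joing_subl _ _)) ?(Mho_expg pG).
suffices peNk: powemb2 'Mho^k(N)%G by split=> //; apply: Mho1Mho.
elim: k => [|k IHk]; first by rewrite (_ : 'Mho^0(N)%G = N) //; apply/val_inj/Mho0.
rewrite (_ : 'Mho^k.+1(N)%G = 'Mho^1('Mho^k(N))%G); first exact: powemb2_Mho1.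
by apply/val_inj; rewrite /= Mho1Mho.
Qed.

(** The step from k to k + 1 squares a product u v d with u, v in 'Mho^k(G) and d
in 'Mho^k.+1(G); these commute modulo 'Mho^k.+2(G), which also contains d^2. *)
Lemma powerful2_expMg k x y :
    G^`(1) \subset 'Mho^2(G) -> x \in G -> y \in G ->
  (x * y) ^+ (2 ^ k) \in 'Mho^k.+1(G) :* (x ^+ (2 ^ k) * y ^+ (2 ^ k)).
Proof.
move=> sG'G4 Gx Gy; have pe_G : powemb2 G.
  split=> //; apply: subset_trans sG'G4 _.
  apply: (Mho_subP pG (B := 'Mho^1('Mho^1(G))%G)) => // z Gz.
  rewrite (expnD 2 1 1) expgM expn1.
  by rewrite (Mho1_expg pG) ?(Mho1_expg pG) ?Mho_sub.
have peA j := (powemb2_Mho_Mho1 j pe_G).1.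
have Mho1A j := (powemb2_Mho_Mho1 j pe_G).2.
have nsA j := (peA j).1; have nA j := subsetP (normal_norm (nsA j)).
elim: k => [|k]; first by rewrite !expg1 rcoset_refl.
set x' := x ^+ (2 ^ k); set y' := y ^+ (2 ^ k).
pose B := 'Mho^k.+2(G)%G.
have [Gx' Gy'] : x' \in G /\ y' \in G by rewrite !groupX.
have hom u v : u \in G -> v \in G -> [~ u, v] \in B ->
    coset B ((u * v) ^+ 2) = coset B (u ^+ 2) * coset B (v ^+ 2).
  have [nsBG nBG] : B <| G /\ G \subset 'N(B) by rewrite normal_norm nsA.
  by move=> Gu Gv Buv; apply: (@coset_expMg_comm _ 2 G B); rewrite ?Mho_sub.
have sRB : [~: 'Mho^k(G), G] \subset B.
  by have:= (peA k).2; rewrite /= !Mho1A.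
have [Ax' Ay'] : x' \in 'Mho^k(G) /\ y' \in 'Mho^k(G) by rewrite !(Mho_expg pG).
rewrite norm_rlcoset ?nA ?groupM // => /lcosetP[d Ad def_xy].
have Gd : d \in G := subsetP (Mho_sub _ _) d Ad.
have Gyd : y' * d \in G by apply: groupM.
apply/rcoset_kercosetP; rewrite ?nA ?groupM ?groupX ?groupM //.
rewrite !expnSr !expgM -/x' -/y' def_xy -mulgA hom ?(subsetP sRB) ?mem_commg //.
rewrite hom ?(subsetP sRB) ?mem_commg // (coset_id (x := d ^+ 2)).
  have [nx2 ny2] := (nA k.+2 _ (groupX 2 Gx'), nA k.+2 _ (groupX 2 Gy')).
  by rewrite mulg1 (morphM _ nx2 ny2).
by have:= Mho1_expg pG (Mho_sub _ _) Ad; rewrite /= Mho1A.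
Qed.

End Powerful2Groups.

(** * The Frattini quotient of a 2-generator p-group *)

Section TwoGenerator.

Variables (gT : finGroupType) (G : {group gT}) (p : nat).
Hypotheses (p_pr : prime p) (pG : p.-group G) (mG : 'm(G) = 2).

Let nPhiG : G \subset 'N('Phi(G)) := gFnorm _ _.

Lemma two_generator : exists x y : gT, <<[set x; y]>> = G.
Proof.
have [B defG cardB] := grank_witness G; rewrite mG in cardB.
have /cards2P[x [y [_ defB]]] : #|B| == 2 by rewrite cardB.
by exists x, y; rewrite -defB.
Qed.

Lemma gen2_eq x y u v :
    <<[set x; y]>> = G -> u \in G -> v \in G ->
    x \in <<[set u; v]>> -> y \in <<[set u; v]>> ->
  <<[set u; v]>> = G.
Proof.
move=> defG Gu Gv Kx Ky; apply/eqP; rewrite eqEsubset; apply/andP; split.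
  by rewrite gen_subG subUset !sub1set Gu.
have: <<[set x; y]>> \subset <<[set u; v]>> by rewrite gen_subG subUset !sub1set Kx.
by rewrite defG.
Qed.

Lemma Phi_quotient_noncyclic : ~~ cyclic (G / 'Phi(G)).
Proof.
apply/negP=> /Phi_quotient_cyclic/cyclicP[x defG].
by have:= grank_min [set x]; rewrite cards1 -/(cycle x) -defG mG.
Qed.

Let V := (G / 'Phi(G))%G.
Let abelV : p.-abelem V := Phi_quotient_abelem pG.

Lemma quotient_Phi_expp x : x \in G -> coset 'Phi(G) x ^+ p = 1.
Proof.
move=> Gx; have [_ _] := and3P abelV.
by move/exponentP; apply; apply: mem_quotient.
Qed.

Section GeneratingPair.

Variables x y : gT.
Hypothesis defG : <<[set x; y]>> = G.

Let Gx : x \in G. Proof. by rewrite -defG mem_gen ?set21. Qed.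
Let Gy : y \in G. Proof. by rewrite -defG mem_gen ?set22. Qed.
Let X := coset 'Phi(G) x.
Let Y := coset 'Phi(G) y.
Let Vx : X \in V. Proof. exact: mem_quotient. Qed.
Let Vy : Y \in V. Proof. exact: mem_quotient. Qed.
Let cXY : commute X Y. Proof. exact: (centsP (abelem_abelian abelV)). Qed.

Lemma quotient_Phi_gen : G / 'Phi(G) = <<[set X; Y]>>.
Proof.
transitivity (<<[set x; y]>> / 'Phi(G)); first by rewrite defG.
rewrite quotient_gen ?subUset ?sub1set ?(subsetP nPhiG) //.
by rewrite quotientU !quotient_set1 ?(subsetP nPhiG).
Qed.

Lemma quotient_Phi_coord b :
  b \in G -> exists i j, [/\ i < p, j < p & coset 'Phi(G) b = X ^+ i * Y ^+ j].
Proof.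
move=> Gb; have: coset 'Phi(G) b \in <[X]> * <[Y]>.
  rewrite -norm_joinEl; last by rewrite cents_norm // cent_cycle cycle_subG; apply/cent1P.
  have ->: <[X]> <*> <[Y]> = G / 'Phi(G) by rewrite quotient_Phi_gen joing_idl joing_idr.
  exact: mem_quotient.
case/mulsgP=> _ _ /cycleP[i ->] /cycleP[j ->] ->.
exists (i %% p), (j %% p); rewrite !ltn_pmod ?prime_gt0 //.
by rewrite !expg_mod // quotient_Phi_expp.
Qed.

(** If p did not divide a, then X would be a power of Y and G / Phi(G), hence
G, would be cyclic. *)
Lemma quotient_Phi_indep1 a b : X ^+ a * Y ^+ b = 1 -> p %| a.
Proof.
move=> XaYb; apply: contraR Phi_quotient_noncyclic => p'a.
suffices XY: X \in <[Y]>.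
  rewrite quotient_Phi_gen (_ : <<_>> = <[Y]>) ?cycle_cyclic //.
  apply/eqP; rewrite eqEsubset gen_subG subUset !sub1set XY cycle_id /=.
  by rewrite cycle_subG mem_gen ?set22.
have eqX: <[X ^+ a]> = <[X]>.
  apply/esym/eqP; rewrite -[_ == _]/(generator _ _) generator_coprime.
  by apply: (@coprime_dvdl _ p); rewrite ?prime_coprime // order_dvdn quotient_Phi_expp.
rewrite -cycle_subG -eqX cycle_subG -(mulgK (Y ^+ b) (X ^+ a)) XaYb mul1g.
by rewrite groupV mem_cycle.
Qed.

End GeneratingPair.

Lemma quotient_Phi_indep x y a b c d (X := coset 'Phi(G) x) (Y := coset 'Phi(G) y) :
    <<[set x; y]>> = G -> X ^+ a * Y ^+ b = X ^+ c * Y ^+ d ->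
  a = c %[mod p] /\ b = d %[mod p].
Proof.
move=> defG eqXY.
have [Gx Gy]: x \in G /\ y \in G by rewrite -defG !mem_gen ?set21 ?set22.
have cXY i j : commute (X ^+ i) (Y ^+ j).
  by apply: (centsP (abelem_abelian abelV)); rewrite groupX // mem_quotient.
have eqXY1 : X ^+ (a + p.-1 * c) * Y ^+ (b + p.-1 * d) = 1.
  rewrite !expgD mulgA -(mulgA (X ^+ a)) (cXY _ b) mulgA eqXY.
  rewrite -(mulgA (X ^+ c)) -(cXY _ d) mulgA -expgD -mulgA -expgD -!mulSn.
  by rewrite prednK ?prime_gt0 // !expgM !quotient_Phi_expp // !expg1n mulg1.
have modp i j : p %| i + p.-1 * j -> i = j %[mod p].
  move=> p_ij; apply/eqP; rewrite -(eqn_modDr (p.-1 * j)) -mulSn prednK ?prime_gt0 //.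
  by rewrite modnMr; apply: p_ij.
split; apply: modp; first exact: quotient_Phi_indep1 defG _ _ eqXY1.
apply: (quotient_Phi_indep1 (x := y) (y := x) _ (b := a + p.-1 * c)); first by rewrite setUC.
by rewrite -(cXY _ _).
Qed.

(** The plane has p^2 elements, so it is the direct product of the line of y
with the line of any member of a generating pair not on it. *)
Lemma generating_pair_compl y :
  y \in G -> y \notin 'Phi(G) -> exists x, <<[set x; y]>> = G.
Proof.
move=> Gy Phi'y; have [u [v defG]] := two_generator.
have [Gu Gv]: u \in G /\ v \in G by rewrite -defG !mem_gen ?set21 ?set22.
pose X z := coset 'Phi(G) z; have VX z : z \in G -> X z \in V by apply: mem_quotient.
have oX z : z \in G -> #[X z] %| p by move=> Gz; rewrite order_dvdn quotient_Phi_expp.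
have ntX z : z \in G -> X z != 1 -> #|<[X z]>| = p.
  by move=> Gz; apply: (abelem_order_p abelV); apply: VX.
have oV : #|V| <= p ^ 2.
  have sVM : V \subset <[X u]> * <[X v]>.
    apply/subsetP=> _ /morphimP[z _ Gz ->].
    have [i [j [_ _]]] := quotient_Phi_coord defG Gz; rewrite /= => ->.
    by rewrite mem_mulg ?mem_cycle.
  apply: leq_trans (subset_leq_card sVM) _.
  apply: leq_trans (leq_pmulr _ (cardG_gt0 (<[X u]> :&: <[X v]>)%G)) _.
  by rewrite -mul_cardG leq_mul // dvdn_leq ?prime_gt0 ?oX.
have ntY : X y != 1 by apply: contra Phi'y => /eqP/coset_idr; apply; apply: subsetP Gy.
have [x Gx Y'x] : exists2 x, x \in G & X x \notin <[X y]>.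
  have [Yu | ] := boolP (X u \in <[X y]>); last by exists u.
  have [Yv | ] := boolP (X v \in <[X y]>); last by exists v.
  case/negP: Phi_quotient_noncyclic; rewrite (quotient_Phi_gen defG).
  by apply: cyclicS (cycle_cyclic (X y)); rewrite gen_subG subUset !sub1set Yu.
exists x; have ntXx : X x != 1 by apply: contraNneq Y'x => ->.
have sXYV : <[X x]> * <[X y]> \subset V by rewrite mul_subG ?cycle_subG ?VX.
have oXY : #|<[X x]> * <[X y]>| = (p ^ 2)%N.
  by rewrite TI_cardMg ?ntX // prime_TIg ?cycle_subG // ntX.
have defV : V :=: <[X x]> * <[X y]>.
  by apply/esym/eqP; rewrite eqEcard sXYV oXY.
have sxyG : [set x; y] \subset G by rewrite subUset !sub1set Gx.
apply: Phi_nongen; apply/eqP; rewrite eqEsubset join_subG Phi_sub sxyG /=.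
rewrite -(quotientSGK nPhiG) ?joing_subl // -[_ / _]/(gval V) defV.
have memX z : z \in [set x; y] -> X z \in 'Phi(G) <*> [set x; y] / 'Phi(G).
  by move=> xyz; apply: mem_quotient; apply: mem_gen; rewrite inE xyz orbT.
by rewrite mul_subG // cycle_subG memX ?set21 ?set22.
Qed.

End TwoGenerator.

(** * Beauville structures and power maps *)

Section Exponent23.

Variable gT : finGroupType.

(** Writing u and v for the conjugates of a under c and c^-1, the cubes of a
c^-1 and a c say that a u v = a v u = 1. So u commutes with v, hence with a =
(u v)^-1. *)
Lemma exponent3_commute (a c : gT) :
  c ^+ 3 = 1 -> (a * c) ^+ 3 = 1 -> (a * c^-1) ^+ 3 = 1 -> commute a [~ a, c].
Proof.
move=> c3 ac3 acV3; pose u := a ^ c; pose v := a ^ c^-1.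
have c2 : c * c = c^-1
  by apply: (mulIg c); rewrite mulVg -[RHS]c3 !expgS expg0 mulg1 mulgA.
have auv : a * u * v = 1.
  rewrite -[RHS]acV3 /u /v /conjg !expgS expg0 invgK mulg1 !mulgA.
  by rewrite -(mulgA _ c c) c2.
have avu : a * v * u = 1.
  rewrite -[RHS]ac3 /u /v /conjg !expgS expg0 invgK mulg1 !mulgA.
  by rewrite -(mulgA _ c^-1 c^-1) -invMg c2 invgK.
have cav : commute u v.
  by apply: (mulgI a); rewrite (mulgA a u) auv (mulgA a v) avu.
have defa : a = (u * v)^-1 by apply: (mulIg (u * v)); rewrite mulVg (mulgA a u).
have cau : commute a u.
  by rewrite defa; apply/commute_sym/commuteV/commuteM.
by rewrite commgEl; apply/commuteM => //; apply: commuteV.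
Qed.

Lemma exponent23_central p (H : {group gT}) a c :
    prime p -> p < 5 -> {in H, forall x, x ^+ p = 1} -> a \in H -> c \in H ->
  commute a [~ a, c].
Proof.
move=> p_pr p_lt5 expH Ha Hc; have [p2 | p_neq2] := eqVneq p 2.
  have sq x : x \in H -> x^-1 = x.
    move=> Hx; apply/eqP; rewrite eq_invg_mul; apply/eqP.
    by rewrite -[RHS](expH x Hx) p2.
  suffices ->: [~ a, c] = 1 by apply: commute1.
  rewrite commgEl conjgE !sq // -[RHS](expH _ (groupM Ha Hc)) p2.
  by rewrite !expgS expg0 mulg1 !mulgA.
have p3 : p = 3 by case: p p_pr p_lt5 p_neq2 {expH} => [|[|[|[|[|]]]]].
by apply: exponent3_commute; rewrite -p3 expH ?groupM ?groupV.
Qed.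

End Exponent23.

Section Beauville.

Variables (gT : finGroupType) (G : {group gT}) (p e : nat).
Hypotheses (p_pr : prime p) (pG : p.-group G) (mG : 'm(G) = 2).
Hypothesis expG : exponent G = (p ^ e)%N.

Let q := (p ^ e.-1)%N.
Let V := (G / 'Phi(G))%G.
Let abelV : p.-abelem V := Phi_quotient_abelem pG.
Let nPhiG : G \subset 'N('Phi(G)) := gFnorm _ _.

(** G is not trivial, so e > 0 and the predecessor is not truncated. *)
Lemma exponent_pq : (p ^ e = q * p)%N.
Proof.
case: e @q expG => [|n] q0 expGe; last by rewrite expnSr.
move/eqP: expGe; rewrite -dvdn1 -trivg_exponent => /eqP G1.
by have:= grank_min (set0 : {set gT}); rewrite gen0 cards0 -G1 mG.
Qed.

Lemma SigmaP x y z :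
  reflect (exists2 a, a \in [:: x; y; x * y] & exists2 g, g \in G & z \in <[a]> :^ g)
          (z \in Sigma G x y).
Proof.
apply: (iffP bigcupP) => [[g Gg] | [a]].
  by rewrite !inE -orbA => /or3P[]; [exists x | exists y | exists (x * y)];
    rewrite ?inE ?eqxx ?orbT //; exists g.
by rewrite !inE => /or3P[]/eqP-> [g Gg zg]; exists g; rewrite // !inE zg ?orbT.
Qed.

Lemma Sigma_sub x y a z :
  a \in [:: x; y; x * y] -> z \in <[a]> -> z \in Sigma G x y.
Proof. by move=> xya az; apply/SigmaP; exists a => //; exists 1; rewrite ?conjsg1. Qed.

Lemma modn_mulIr m a b : ~~ (p %| m) -> a * m = b * m %[mod p] -> a = b %[mod p].
Proof.
move=> p'm; wlog leba : a b / b <= a => [IH | /eqP].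
  by case: (leqP b a) => [/IH// | /ltnW/IH{}IH eqm]; apply/esym/IH/esym.
rewrite eqn_mod_dvd ?leq_mul2r ?leba ?orbT // -mulnBl Euclid_dvdM // (negPf p'm) orbF.
by move=> pab; apply/eqP; rewrite eqn_mod_dvd.
Qed.

Lemma cycle_expp_root u w :
  u \in G -> u ^+ q != 1 -> w \in <[u]> -> w ^+ p = 1 -> exists m, w = (u ^+ m) ^+ q.
Proof.
move=> Gu uq /cycleP[m ->] /eqP; rewrite -expgM -order_dvdn.
have /(dvdn_pfactor _ _ p_pr)[s les def_u] : #[u] %| p ^ e.
  by rewrite -expG dvdn_exponent.
have def_s : s = e.
  apply/eqP; rewrite eqn_leq les leqNgt; apply: contra uq => lts.
  by rewrite -order_dvdn def_u dvdn_exp2l //; case: (e) lts.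
rewrite def_u def_s exponent_pq dvdn_pmul2r ?prime_gt0 // => /dvdnP[n ->].
by exists n; rewrite -expgM.
Qed.

Lemma order_p_power z : z \in G -> z != 1 ->
  exists w, [/\ w \in <[z]>, w ^+ p = 1 & w != 1].
Proof.
move=> Gz ntz; have /p_natP[f def_z] := mem_p_elt pG Gz.
case: f def_z => [/eqP|f def_z]; first by rewrite order_eq1 (negPf ntz).
exists (z ^+ (p ^ f)); rewrite mem_cycle -expgM -expnSr -def_z expg_order.
split=> //; rewrite -order_dvdn def_z dvdn_Pexp2l ?prime_gt1 //.
by rewrite ltnn.
Qed.

(** If conjugates of <a> and <b> meet nontrivially, they share an element of
order p, which is a q-th power u^(mq) = v^(nq) of elements of both, with m
prime to p.  Then u^m and v^n agree modulo Phi(G), so a and b lie on the same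
line of the plane: the determinant of their coordinates vanishes modulo p.
The lines of x, y, xy have slopes 0, infinity, 1, those of x y^2, x y^4 and
of their product have slopes 2, 4, 3; all nine determinants are among
1, 2, 3, 4, 6 up to sign, and no prime p >= 5 divides these. *)
Lemma Beauville_of_power_fibres :
    5 <= p ->
    {in G &, forall x y, x ^+ q = y ^+ q -> x * y^-1 \in 'Phi(G)} ->
  Beauville_group G.
Proof.
move=> p_ge5 inj_q; have [x [y defG]] := two_generator mG.
have [Gx Gy]: x \in G /\ y \in G by rewrite -defG !mem_gen ?set21 ?set22.
pose X z := coset 'Phi(G) z.
have defX z : z \in G -> z \in 'N('Phi(G)) by apply: subsetP.
pose coord a i j := a \in G /\ X a = X x ^+ i * X y ^+ j.
have cXY i j : commute (X x ^+ i) (X y ^+ j).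
  by apply: (centsP (abelem_abelian abelV)); rewrite groupX // mem_quotient.
have coordM a i j b k l : coord a i j -> coord b k l ->
    coord (a * b) (i + k)%N (j + l)%N.
  move=> [Ga Xa] [Gb Xb]; split; first exact: groupM.
  rewrite /X morphM ?defX //= -/(X a) -/(X b) Xa Xb !expgD.
  by rewrite -!mulgA; congr (_ * _); rewrite !mulgA cXY.
have coordX a i j m : coord a i j -> coord (a ^+ m) (i * m)%N (j * m)%N.
  move=> cd; elim: m => [|m IHm]; last by rewrite expgS !mulnS; apply: coordM.
  by rewrite !muln0; split; rewrite ?group1 // /X morph1 mulg1.
have cx : coord x 1%N 0%N by split; rewrite ?expg1 ?mulg1.
have cy : coord y 0%N 1%N by split; rewrite ?expg1 ?mul1g.
have coordJ a i j g : g \in G -> coord a i j -> coord (a ^ g) i j.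
  move=> Gg [Ga Xa]; split; first exact: groupJ.
  rewrite -Xa /X morphJ ?defX //= /conjg.
  by rewrite (centsP (abelem_abelian abelV) (coset _ a) _ (coset _ g) _) ?mem_quotient // mulKg.
(* A nonzero determinant forces trivial intersection; u and v are the
   conjugates of a and b, which have the same coordinates. *)
have key a i j b k l g h z : coord a i j -> coord b k l -> i * l != j * k %[mod p] ->
    g \in G -> h \in G -> z \in <[a]> :^ g -> z \in <[b]> :^ h -> z = 1.
  move=> ca cb neq Gg Gh; rewrite -!cycleJ.
  have := coordJ _ _ _ _ Gg ca; have := coordJ _ _ _ _ Gh cb.
  move: (a ^ g) (b ^ h) => u v {}cb {}ca {a b g h Gg Gh} uz vz.
  have [[Gu Xu] [Gv Xv]] := (ca, cb).
  apply/eqP; apply: contraT => ntz.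
  have Gz : z \in G by apply: subsetP uz; rewrite cycle_subG.
  have [w [zw wp ntw]] := order_p_power Gz ntz.
  have [uw vw] : w \in <[u]> /\ w \in <[v]>.
    by split; apply: subsetP zw; rewrite cycle_subG.
  have uq a c d : coord a c d -> a ^+ q = 1 -> c = 0 %[mod p] /\ d = 0 %[mod p].
    move=> [Ga Xa] aq; apply: (quotient_Phi_indep p_pr pG mG defG).
    rewrite -Xa mulg1 /X coset_id // -(mulg1 a) -invg1 inj_q ?group1 //.
    by rewrite aq expg1n.
  have [m def_w] : exists m, w = (u ^+ m) ^+ q.
    apply: cycle_expp_root => //; apply: contraNneq neq => /(uq _ _ _ ca)[i0 j0].
    by rewrite -modnMml i0 -[X in _ == X]modnMml j0 !modnMml !mul0n.
  have [n def_w'] : exists n, w = (v ^+ n) ^+ q.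
    apply: cycle_expp_root => //; apply: contraNneq neq => /(uq _ _ _ cb)[k0 l0].
    by rewrite -modnMmr l0 -[X in _ == X]modnMmr k0 !modnMmr !muln0.
  have p'm : ~~ (p %| m).
    apply: contra ntw => /dvdnP[m' def_m]; rewrite def_w def_m -expgM.
    have -> : (m' * p * q = q * p * m')%N by rewrite mulnC mulnCA mulnC.
    by rewrite expgM -exponent_pq -expG expg_exponent // expg1n.
  have [_ Xum] := coordX _ _ _ m ca; have [_ Xvn] := coordX _ _ _ n cb.
  have eqX : X (u ^+ m) = X (v ^+ n).
    apply/rcoset_kercosetP; rewrite ?defX ?groupX // mem_rcoset.
    by apply: inj_q; rewrite ?groupX // -def_w.
  have [im jm] : i * m = k * n %[mod p] /\ j * m = l * n %[mod p].
    by apply: (quotient_Phi_indep p_pr pG mG defG); rewrite -[LHS]Xum eqX.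
  case/negP: neq; apply/eqP; apply: (modn_mulIr p'm).
  rewrite [(i * l * m)%N]mulnAC -modnMml im modnMml.
  rewrite [(j * k * m)%N]mulnAC -[RHS]modnMml jm modnMml.
  by congr (_ %% p); rewrite -mulnA mulnC (mulnC n).
pose x2 := x * y ^+ 2; pose y2 := x * y ^+ 4.
exists x, y, x2, y2; split=> //.
  have [Kx2 Ky2] : x2 \in <<[set x2; y2]>> /\ y2 \in <<[set x2; y2]>>.
    by rewrite !mem_gen ?set21 ?set22.
  have Ky2' : y ^+ 2 \in <<[set x2; y2]>>.
    have <- : x2^-1 * y2 = y ^+ 2
      by rewrite /x2 /y2 (expgD y 2 2 : y ^+ 4 = _) invMg -mulgA !mulKg.
    exact: groupM (groupVr Kx2) Ky2.
  have Ky : y \in <<[set x2; y2]>>.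
    have gen_y2 : generator <[y]> (y ^+ 2).
      rewrite generator_coprime; have /p_natP[f ->] := mem_p_elt pG Gy.
      by rewrite coprimeXl // prime_coprime // gtnNdvd // (leq_trans _ p_ge5).
    by rewrite -cycle_subG (eqP gen_y2) cycle_subG.
  have Kx : x \in <<[set x2; y2]>> by rewrite -(mulgK (y ^+ 2) x); apply: groupM Kx2 (groupVr Ky2').
  by apply: gen2_eq defG _ _ Kx Ky; rewrite groupM ?groupX.
have cxy := coordM _ _ _ _ _ _ cx cy.
have cx2 := coordM _ _ _ _ _ _ cx (coordX _ _ _ 2 cy).
have cy2 := coordM _ _ _ _ _ _ cx (coordX _ _ _ 4 cy).
have cxy2 := coordM _ _ _ _ _ _ cx2 cy2.
apply/setP=> z; rewrite in_set1 inE; apply/andP/eqP; last first.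
  by move->; split; [apply: (@Sigma_sub x y x) | apply: (@Sigma_sub x2 y2 x2)];
    rewrite ?inE ?eqxx ?group1.
case=> /SigmaP[a xya [g Gg az]] /SigmaP[b xyb [h Gh bz]].
have notdvd d : d \in [:: 1; 2; 3; 4; 6]%N -> ~~ (p %| d).
  move=> Dd; apply: contraL p_ge5 => p_d; rewrite -ltnNge ltnS.
  have: p \in primes d.
    by rewrite mem_primes p_pr p_d andbT; move: Dd; case: (d).
  by move: Dd; rewrite !inE => /or4P[/eqP->|/eqP->|/eqP->|/orP[]/eqP->]; rewrite ?inE => // ;
    [move/eqP-> | move/eqP-> | move/eqP-> | case/orP=> /eqP->].
have neq m n : m < n -> n - m \in [:: 1; 2; 3; 4; 6]%N -> m != n %[mod p] /\ n != m %[mod p].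
  move=> ltmn /notdvd p'd; split; last rewrite eq_sym;
    by rewrite eq_sym eqn_mod_dvd // ltnW.
have fin a' i j b' k l : coord a' i j -> coord b' k l ->
    i * l != j * k %[mod p] -> a = a' -> b = b' -> z = 1.
  by move=> ca cb ne ea eb; apply: (key _ _ _ _ _ _ _ _ _ ca cb ne Gg Gh); rewrite -?ea -?eb.
move: xya xyb; rewrite !inE.
case/or3P=> /eqP ea; case/or3P=> /eqP eb.
- by apply: (fin _ _ _ _ _ _ cx cx2 _ ea eb); case: (neq 0%N 2).
- by apply: (fin _ _ _ _ _ _ cx cy2 _ ea eb); case: (neq 0%N 4).
- by apply: (fin _ _ _ _ _ _ cx cxy2 _ ea eb); case: (neq 0%N 6).
- by apply: (fin _ _ _ _ _ _ cy cx2 _ ea eb); case: (neq 0%N 1%N).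
- by apply: (fin _ _ _ _ _ _ cy cy2 _ ea eb); case: (neq 0%N 1%N).
- by apply: (fin _ _ _ _ _ _ cy cxy2 _ ea eb); case: (neq 0%N 2).
- by apply: (fin _ _ _ _ _ _ cxy cx2 _ ea eb); case: (neq 1%N 2).
- by apply: (fin _ _ _ _ _ _ cxy cy2 _ ea eb); case: (neq 1%N 4).
- by apply: (fin _ _ _ _ _ _ cxy cxy2 _ ea eb); case: (neq 2 6).
Qed.


Section SemiAbelian.

Hypothesis semi : forall x y : gT, x \in G -> y \in G ->
  (x ^+ q = y ^+ q <-> (x * y^-1) ^+ q = 1).

(** The subgroup called Omega above. *)
Definition powroot := [set x in G | x ^+ q == 1].

Lemma powroot_group_set : group_set powroot.
Proof.
apply/group_setP; split=> [|x y]; first by rewrite inE group1 expg1n eqxx.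
rewrite !inE => /andP[Gx /eqP xq] /andP[Gy /eqP yq]; rewrite groupM //=.
rewrite -[y]invgK; apply/eqP; apply: (semi Gx (groupVr Gy)).1.
by rewrite expgVn xq yq invg1.
Qed.
Canonical powroot_group := Group powroot_group_set.

Lemma powroot_normal : powroot <| G.
Proof.
apply/andP; split; first by apply/subsetP=> x /setIdP[].
apply/subsetP=> g Gg; rewrite inE; apply/subsetP=> _ /imsetP[x /setIdP[Gx /eqP xq] ->].
by rewrite inE groupJ //= -conjXg xq conj1g.
Qed.

Lemma eq_expq x y : x \in G -> y \in G -> x * y^-1 \in powroot -> x ^+ q = y ^+ q.
Proof. by move=> Gx Gy /setIdP[_ /eqP/(semi Gx Gy).2]. Qed.

Lemma powroot_expp x : x \in G -> x ^+ p \in powroot.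
Proof.
move=> Gx; rewrite inE groupX //= -expgM mulnC -exponent_pq -expG.
by rewrite expg_exponent.
Qed.

(** A root of 1 outside Phi(G) extends to a generating pair x, y, so that G is
the product of <x> and the group of roots of 1; then all q-th powers are
powers of x^q. *)
Lemma powroot_sub_Phi : p ^ 2 <= #|'Mho^(e.-1)(G)| -> powroot \subset 'Phi(G).
Proof.
rewrite leqNgt; apply: contraR => /subsetPn[y /setIdP[Gy yq] Phi'y].
have [x defG] := generating_pair_compl p_pr pG mG Gy Phi'y.
have Gx : x \in G by rewrite -defG mem_gen ?set21.
have Ry : y \in powroot by rewrite inE Gy.
have nRx : <[x]> \subset 'N(powroot).
  by rewrite (subset_trans _ (normal_norm powroot_normal)) // cycle_subG.
have sGxR : G \subset <[x]> * powroot.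
  rewrite -norm_joinEl //.
  have: <<[set x; y]>> \subset <[x]> <*> powroot.
    rewrite gen_subG subUset !sub1set (subsetP (joing_subl _ _)) ?cycle_id //.
    exact: subsetP (joing_subr _ _) _ Ry.
  by rewrite defG.
suffices sWx : 'Mho^(e.-1)(G) \subset <[x ^+ q]>.
  apply: leq_ltn_trans (subset_leq_card sWx) _.
  apply: (@leq_ltn_trans p); last by rewrite ltn_Pmulr ?prime_gt1 ?prime_gt0.
  rewrite dvdn_leq ?prime_gt0 // order_dvdn -expgM -exponent_pq -expG.
  by rewrite expg_exponent.
apply: (Mho_subP pG (B := <[x ^+ q]>%G)) => // z Gz.
have /mulsgP[_ r /cycleP[i ->] Rr def_z] := subsetP sGxR z Gz.
have Gxi : x ^+ i \in G by apply: groupX.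
rewrite (@eq_expq z (x ^+ i)) //; first by rewrite -expgM mulnC expgM mem_cycle.
have ->: z * (x ^+ i)^-1 = r ^ (x ^+ i)^-1 by rewrite def_z conjgE invgK mulgA.
by rewrite memJ_norm // groupV (subsetP nRx) ?mem_cycle.
Qed.

Lemma generating_pair_expq_neq1 x y :
  <<[set x; y]>> = G -> exists2 a, a \in [:: x; y; x * y] & a ^+ q != 1.
Proof.
move=> defG; have [Gx Gy]: x \in G /\ y \in G by rewrite -defG !mem_gen ?set21 ?set22.
have [xq | ] := eqVneq (x ^+ q) 1; last by exists x; rewrite ?inE ?eqxx.
have [yq | ] := eqVneq (y ^+ q) 1; last by exists y; rewrite ?inE ?eqxx ?orbT.
have: <<[set x; y]>> \subset powroot.
  by rewrite gen_subG subUset !sub1set !inE Gx Gy xq yq eqxx.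
rewrite defG => sGR; have: exponent G %| q.
  by apply/exponentP=> z /(subsetP sGR) /setIdP[_ /eqP].
have q_gt0 : 0 < q by rewrite expn_gt0 prime_gt0.
rewrite expG exponent_pq => /(dvdn_leq q_gt0).
by rewrite leqNgt => /negP[]; rewrite ltn_Pmulr ?prime_gt1.
Qed.

(** W is a nontrivial p-group of order less than p^2, so it is generated by
the nontrivial q-th power of a member of either generating pair; both sets
Sigma contain W. *)
Lemma not_Beauville_small_Mho :
  #|'Mho^(e.-1)(G)| < p ^ 2 -> ~ Beauville_group G.
Proof.
move=> ltW [x1 [y1 [x2 [y2 [defG1 defG2 TI]]]]].
have [a1 xya1 a1q] := generating_pair_expq_neq1 defG1.
have [a2 xya2 a2q] := generating_pair_expq_neq1 defG2.
have memG x y a : <<[set x; y]>> = G -> a \in [:: x; y; x * y] -> a \in G.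
  move=> defG; have [Gx Gy]: x \in G /\ y \in G by rewrite -defG !mem_gen ?set21 ?set22.
  by rewrite !inE => /or3P[]/eqP->; rewrite ?groupM.
have [Ga1 Ga2] := (memG _ _ _ defG1 xya1, memG _ _ _ defG2 xya2).
pose W := 'Mho^(e.-1)(G)%G; have sWG : W \subset G := Mho_sub _ _.
have Wa a : a \in G -> a ^+ q \in W by apply: (Mho_expg pG).
have oW : #|W| = p.
  have [k def_oW] := p_natP (pgroupS sWG pG).
  move: ltW; rewrite -/W def_oW ltn_exp2l ?prime_gt1 //.
  case: k def_oW => [|[|//]] def_oW _; last by rewrite expn1.
  by have:= Wa a1 Ga1; rewrite (card1_trivg def_oW) inE (negPf a1q).
have defW : W :=: <[a1 ^+ q]>.
  apply/esym/eqP; rewrite eqEcard cycle_subG Wa //= oW dvdn_leq ?cardG_gt0 //.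
  have: #[a1 ^+ q] %| p by rewrite -oW order_dvdG ?Wa.
  by case/primeP: (p_pr) => _ p_pr' /p_pr'; rewrite order_eq1 (negPf a1q) => /eqP<-.
suffices: a2 ^+ q \in Sigma G x1 y1 :&: Sigma G x2 y2.
  by rewrite TI inE (negPf a2q).
rewrite inE.
rewrite (Sigma_sub xya2) ?mem_cycle // (Sigma_sub xya1) //.
have: a2 ^+ q \in <[a1 ^+ q]> by rewrite -defW Wa.
by apply: subsetP; rewrite cycle_subG mem_cycle.
Qed.

(** In H = G / Omega, of exponent p < 5, the commutator z of the images A, C
of a, c is central and generates H' = Phi(H).  So the image of b is
A^k z^j for some j, and conjugating A^k by C^m multiplies it by z^(km). *)
Lemma coset_Phi_conj a c b k :
    p < 5 -> 0 < k < p -> <<[set a; c]>> = G -> b \in G ->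
    coset 'Phi(G) b = coset 'Phi(G) a ^+ k ->
  exists2 g, g \in G & b * ((a ^+ k) ^ g)^-1 \in powroot.
Proof.
move=> p_lt5 k_bounds defG Gb eq_ba; pose R := powroot_group.
have [Ga Gc]: a \in G /\ c \in G by rewrite -defG !mem_gen ?set21 ?set22.
have nRG : G \subset 'N(R) := normal_norm powroot_normal.
have nR z : z \in G -> z \in 'N(R) by apply: subsetP.
pose H := (G / R)%G; pose A := coset R a; pose C := coset R c; pose z := [~ A, C].
have expH : {in H, forall h, h ^+ p = 1}.
  by move=> _ /morphimP[h nh Gh ->]; rewrite -morphX //= coset_id ?powroot_expp.
have [HA HC] : A \in H /\ C \in H by rewrite !mem_quotient.
have cAz : commute A z := exponent23_central p_pr p_lt5 expH HA HC.
have cCz : commute C z.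
  by rewrite /z -invg_comm; apply: commuteV; apply: exponent23_central expH HC HA.
have defH : H :=: <[A]> <*> <[C]>.
  transitivity (<<[set a; c]>> / R); first by rewrite defG.
  rewrite quotient_gen ?subUset ?sub1set ?nR // quotientU !quotient_set1 ?nR //.
  by rewrite joing_idl joing_idr.
have defH' : H^`(1) = <[z]>.
  by rewrite defH der1_joing_cycles // centY !cent_cycle inE; apply/andP; split; apply/cent1P.
have zp : z ^+ p = 1 by apply: expH; rewrite groupR.
pose f := (a ^+ k)^-1 * b; have Gf : f \in G by rewrite groupM ?groupV ?groupX.
have Phi_f : f \in 'Phi(G).
  apply: coset_idr; first exact: subsetP Gf.
  rewrite morphM ?morphV ?groupV ?(subsetP nPhiG) ?groupX //= eq_ba.
  by rewrite morphX ?(subsetP nPhiG) //= mulVg.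
have /cycleP[j def_f] : coset R f \in <[z]>.
  have pH : p.-group H by apply: quotient_pgroup.
  have Mho_H : 'Mho^1(H) = 1.
    apply/trivgP; apply: (Mho_subP pH (B := 1%G)) => // h Hh.
    by rewrite expn1 expH ?group1.
  have PhiH : 'Phi(H) = <[z]> by rewrite (Phi_joing pH) Mho_H joingG1.
  by rewrite -PhiH -(quotient_Phi pG nRG) mem_quotient.
(* k is its own inverse modulo p, since p is 2 or 3; so m = j k solves
   k m = j. *)
exists (c ^+ (j * k)); first by rewrite groupX.
have Gak : a ^+ k \in G by rewrite groupX.
have Gg : c ^+ (j * k) \in G by rewrite groupX.
rewrite -[_ \in _]mem_rcoset; apply/rcoset_kercosetP; rewrite ?nR ?groupJ //.
have -> : b = a ^+ k * f by rewrite mulKVg.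
rewrite (morphM _ (nR _ Gak) (nR _ Gf)) (morphJ _ (nR _ Gak) (nR _ Gg)) /=.
rewrite def_f conjg_mulR; congr (_ * _).
rewrite !morphX ?nR //= commXXg // -/A -/C -/z mulnCA.
rewrite -(expg_mod j zp) -(expg_mod (j * _) zp); congr (_ ^+ _).
have kk1 : k * k = 1 %[mod p].
  have p23 : p = 2 \/ p = 3.
    by case: p p_pr p_lt5 => [|[|[|[|[|]]]]] // _ _; [left | right].
  by move: k_bounds; case: p23 => ->; case: (k) => [|[|[|]]].
by rewrite -modnMmr kk1 modnMmr muln1.
Qed.

(** For p < 5 the only line that may escape x, y and xy is that of x y^-1. *)
Lemma generating_pair_line x y b :
    p < 5 -> <<[set x; y]>> = G -> b \in G ->
    coset 'Phi(G) b \notin <[coset 'Phi(G) x * (coset 'Phi(G) y)^-1]> ->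
  exists a c k, [/\ a \in [:: x; y; x * y], <<[set a; c]>> = G, 0 < k < p
    & coset 'Phi(G) b = coset 'Phi(G) a ^+ k].
Proof.
move=> p_lt5 defG Gb; have [Gx Gy]: x \in G /\ y \in G by rewrite -defG !mem_gen ?set21 ?set22.
have [i [j [ltip ltjp ->]]] := quotient_Phi_coord p_pr pG defG Gb.
set X := coset _ x; set Y := coset _ y.
have cXY : commute X Y by apply: (centsP (abelem_abelian abelV)); rewrite mem_quotient.
have [Xp Yp] : X ^+ p = 1 /\ Y ^+ p = 1 by rewrite !(quotient_Phi_expp pG).
have defG' : <<[set x * y; y]>> = G.
  have [Kxy Ky] : x * y \in <<[set x * y; y]>> /\ y \in <<[set x * y; y]>>.
    by rewrite !mem_gen ?set21 ?set22.
  have Kx : x \in <<[set x * y; y]>> by rewrite -(groupMr _ Ky).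
  by apply: gen2_eq defG _ _ Kx Ky; rewrite ?groupM.
have XYE : coset 'Phi(G) (x * y) = X * Y by rewrite morphM ?(subsetP nPhiG).
have [-> | j_gt0] := posnP j.
  have [-> | i_gt0 _] := posnP i; first by rewrite mulg1 group1.
  by exists x, y, i; rewrite inE eqxx mulg1 i_gt0.
have [-> _ | i_gt0] := posnP i.
  by exists y, x, j; rewrite !inE eqxx orbT setUC defG mul1g j_gt0.
have [-> _ | neq_ij] := eqVneq i j.
  by exists (x * y), y, j; rewrite !inE eqxx !orbT defG' j_gt0 XYE expgMn.
case/negP; have [p3 ij3] : p = 3 /\ (i + j = 3)%N.
  case: p ltip ltjp p_lt5 p_pr => [|[|[|[|[|p']]]]] //;
    by case: (i) (j) i_gt0 j_gt0 neq_ij => [|[|[|i']]] [|[|[|j']]].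
rewrite (_ : Y ^+ j = Y ^- i); last first.
  by apply: (mulIg (Y ^+ i)); rewrite mulVg -expgD addnC ij3 -p3 Yp.
by rewrite -expgVn -expgMn ?mem_cycle //; apply: commuteV.
Qed.

(** The second pair generates G, so one of its members b avoids the line of
x1 y1^-1 and falls on a line of the first triple. *)
Lemma not_Beauville_lt5 : powroot \subset 'Phi(G) -> p < 5 -> ~ Beauville_group G.
Proof.
move=> sRPhi p_lt5 [x1 [y1 [x2 [y2 [defG1 defG2 TI]]]]].
set L := <[coset 'Phi(G) x1 * (coset 'Phi(G) y1)^-1]>.
have [Gx Gy]: x2 \in G /\ y2 \in G by rewrite -defG2 !mem_gen ?set21 ?set22.
have [b xyb [Gb Lb]] : exists2 b, b \in [:: x2; y2; x2 * y2] & b \in G /\ coset 'Phi(G) b \notin L.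
  have [Lx | ] := boolP (coset 'Phi(G) x2 \in L); last by exists x2; rewrite ?inE ?eqxx.
  have [Ly | ] := boolP (coset 'Phi(G) y2 \in L); last by exists y2; rewrite ?inE ?eqxx ?orbT.
  case/negP: (Phi_quotient_noncyclic mG); rewrite (quotient_Phi_gen defG2).
  apply: cyclicS (cycle_cyclic (coset 'Phi(G) x1 * (coset 'Phi(G) y1)^-1)).
  by rewrite gen_subG subUset !sub1set Lx.
have [a [c [k [xya defG k_bounds eq_ba]]]] := generating_pair_line p_lt5 defG1 Gb Lb.
have Ga : a \in G by rewrite -defG mem_gen ?set21.
have [g Gg Rba] := coset_Phi_conj p_lt5 k_bounds defG Gb eq_ba.
have bq : b ^+ q = (a ^+ k ^+ q) ^ g by rewrite conjXg (eq_expq _ _ Rba) // groupJ // groupX.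
have ntbq : b ^+ q != 1.
  apply: contra Lb => bq1; rewrite coset_id ?group1 //.
  by apply: (subsetP sRPhi); rewrite inE Gb.
suffices: b ^+ q \in Sigma G x1 y1 :&: Sigma G x2 y2 by rewrite TI inE (negPf ntbq).
rewrite inE (Sigma_sub xyb) ?mem_cycle // andbT; apply/SigmaP; exists a => //.
by exists g; rewrite // bq memJ_conjg -expgM mem_cycle.
Qed.

Lemma semi_Beauville_iff :
  Beauville_group G <-> 5 <= p /\ p ^ 2 <= #|'Mho^(e.-1)(G)|.
Proof.
split=> [BG | [p_ge5 W_ge]].
  have W_ge : p ^ 2 <= #|'Mho^(e.-1)(G)|.
    by rewrite leqNgt; apply/negP=> ltW; apply: not_Beauville_small_Mho BG.
  split=> //; rewrite leqNgt; apply/negP=> p_lt5.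
  exact: not_Beauville_lt5 (powroot_sub_Phi W_ge) p_lt5 BG.
apply: Beauville_of_power_fibres => // x y Gx Gy /(semi Gx Gy).1 xyq.
apply: (subsetP (powroot_sub_Phi W_ge)).
by rewrite inE groupM ?groupV //= xyq.
Qed.

End SemiAbelian.

End Beauville.

(** * The two cases of the theorem *)

Lemma semi_of_expM (gT : finGroupType) (G : {group gT}) n :
    {in G &, forall x y, (x * y) ^+ n = x ^+ n * y ^+ n} ->
  forall x y : gT, x \in G -> y \in G ->
  (x ^+ n = y ^+ n <-> (x * y^-1) ^+ n = 1).
Proof.
move=> expM x y Gx Gy; rewrite expM ?groupV // expgVn; split=> [->|].
  by rewrite mulgV.
by move/eqP; rewrite -eq_mulgV1 => /eqP.
Qed.

Section PotentBeauville.

Variables (gT : finGroupType) (G : {group gT}) (p e : nat).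
Hypotheses (p_pr : prime p) (pG : p.-group G) (mG : 'm(G) = 2).
Hypothesis expG : exponent G = (p ^ e)%N.

Let q := (p ^ e.-1)%N.

Lemma exponent_dvd_pS : exponent G %| p ^ e.-1.+1.
Proof. by rewrite expG (exponent_pq mG expG) expnSr. Qed.

Lemma powerful2_expM_last :
    p = 2 -> G^`(1) \subset 'Mho^2(G) ->
  {in G &, forall x y, (x * y) ^+ q = x ^+ q * y ^+ q}.
Proof.
move=> p2 sG'G4 x y Gx Gy; rewrite /q p2.
have pG2 : 2.-group G by rewrite -p2.
have := powerful2_expMg pG2 e.-1 sG'G4 Gx Gy.
have -> : 'Mho^e.-1.+1(G) = 1.
  apply/trivgP; apply: (Mho_subP pG2 (B := 1%G)) => // z Gz.
  by rewrite inE -p2 (exponentP exponent_dvd_pS).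
by rewrite mul1g => /set1P.
Qed.

Hypothesis peG : potemb p G G.

Let W := 'Mho^(e.-1)(G)%G.
Let R := [~: W, G]%G.
Let nsWG : W <| G := Mho_normal _ _.
Let nsRG : R <| G := commg_normal_trans nsWG.
Let nRG := subsetP (normal_norm nsRG).

Lemma potent_expM_last :
  R :=: 1 -> {in G &, forall x y, (x * y) ^+ q = x ^+ q * y ^+ q}.
Proof.
move=> R1 x y Gx Gy; have := potent_expMg p_pr pG peG e.-1 Gx Gy.
rewrite -morphM ?nRG ?groupX // => /rcoset_kercosetP.
rewrite !nRG ?groupM ?groupX ?groupM // => /(_ isT isT).
by rewrite -/R R1 mul1g => /set1P.
Qed.

(** Equal q-th powers of x and y put the q-th power of x y^-1 in R; if x y^-1
were outside Phi(G), it would belong to a generating pair, and R would be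
trivial. *)
Lemma potent_power_fibres :
    R :!=: 1 ->
  {in G &, forall x y, x ^+ q = y ^+ q -> x * y^-1 \in 'Phi(G)}.
Proof.
move=> ntR x y Gx Gy eq_xy; apply: contraR ntR => Phi'xy.
have Gxy : x * y^-1 \in G by rewrite groupM ?groupV.
have [u defG] := generating_pair_compl p_pr pG mG Gxy Phi'xy.
apply/eqP; apply: (potent_Mho_central p_pr pG peG (esym defG)).
apply: coset_idr; first by rewrite nRG ?groupX.
have GVy := groupVr Gy.
rewrite (potent_expMg p_pr pG peG e.-1 Gx GVy) -morphM ?nRG ?groupX //.
by rewrite expgVn eq_xy mulgV morph1.
Qed.

Lemma potent_card_Mho : R :!=: 1 -> p ^ 2 <= #|W|.
Proof.
move=> ntR; have pW : p.-group W := pgroupS (normal_sub nsWG) pG.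
have ntW : W :!=: 1 by apply: contraNneq ntR => W1; rewrite /R /= -/W W1 comm1G.
have prRW := nil_comm_proper (pgroup_nil pG) nsWG ntW.
have pR : p.-group R := pgroupS (proper_sub prRW) pW.
have := proper_card prRW; rewrite -/(gval R).
have [[i oR] [j oW]] := (p_natP pR, p_natP pW).
have p_gt1 := prime_gt1 p_pr.
rewrite oR oW ltn_exp2l // leq_exp2l // => ltij.
apply: leq_ltn_trans ltij; rewrite lt0n; apply: contraNneq ntR => i0.
by rewrite (card1_trivg (_ : #|R| = 1%N)) // oR i0.
Qed.

(** If R <> 1, both sides of the equivalence hold. *)
Lemma potent_odd_Beauville_iff :
  p != 2 -> Beauville_group G <-> 5 <= p /\ p ^ 2 <= #|'Mho^(e.-1)(G)|.
Proof.
move=> p_neq2; have [R1 | ntR] := eqVneq (gval R) 1.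
  exact: semi_Beauville_iff p_pr pG mG expG (semi_of_expM (potent_expM_last R1)).
have p_ge5 : 5 <= p.
  have p_neq3 : p != 3.
    apply: contraNneq ntR => p3.
    by apply/eqP; apply: (potent3_Mho_central p_pr pG peG p3 exponent_dvd_pS).
  by case: p p_pr p_neq2 p_neq3 => [|[|[|[|[|]]]]].
split=> _; first by split=> //; apply: potent_card_Mho.
exact: Beauville_of_power_fibres p_pr pG mG expG p_ge5 (potent_power_fibres ntR).
Qed.

End PotentBeauville.

Theorem theoremA (gT : finGroupType) (G : {group gT}) (p e : nat) :
  prime p -> p.-group G -> 'm(G) = 2 -> exponent G = (p ^ e)%N ->
  (forall x y : gT, x \in G -> y \in G ->
     (x ^+ (p ^ e.-1) = y ^+ (p ^ e.-1) <-> (x * y^-1) ^+ (p ^ e.-1) = 1))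
  \/ potent p G ->
  (Beauville_group G <-> (5 <= p)%N /\ (p ^ 2 <= #|'Mho^(e.-1)(G)|)%N).
Proof.
move=> p_pr pG mG expG [semi | /andP[_]].
  exact: semi_Beauville_iff p_pr pG mG expG semi.
have [p2 sG'G4 | p_neq2 sLG] := eqVneq p 2.
  apply: (semi_Beauville_iff p_pr pG mG expG).
  exact: semi_of_expM (powerful2_expM_last pG mG expG p2 sG'G4).
apply: (potent_odd_Beauville_iff p_pr pG mG expG) => //; split=> //.
have defp1 : p.-1 = (p - 2).+1.
  by case: p p_pr p_neq2 {pG expG sLG} => [|[|[|p']]] //=; rewrite subn2.
suffices -> : itercomm G G (p - 2) :=: 'L_(p.-1)(G) by [].
by rewrite defp1; elim: (p - 2) => // n IHn; rewrite lcnSn -IHn.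
Qed.
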